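(* The subvarieties generated by finite subsets of the set $\{\mathbf{F}_n(\mathbb{Z}) : n\in\mathbb{Z}^+\}$ form an ideal of the subvariety lattice of the variety $\mathsf{DLP}$ of distributive $\ell$-pregroups. This ideal is isomorphic, as a lattice, to the lattice $\mathcal{O}_{\mathrm{fin}}(\mathbf{D})$ of finite downsets of $\mathbf{D}=(\mathbb{Z}^+,\mid)$ via the map $S\mapsto \mathbb{V}(\{\mathbf{F}_k(\mathbb{Z}) : k\in S\})$.
   Context: An $\ell$-pregroup is an algebra $(A,\wedge,\vee,\cdot,1,{}^{\ell},{}^{r})$ such that $(A,\wedge,\vee)$ is a lattice, $(A,\cdot,1)$ is a monoid, multiplication is order-preserving in both arguments, and $a^{\ell}a\le 1\le aa^{\ell}$ and $aa^{r}\le 1\le a^{r}a$ for all $a\in A$. It is distributive if its lattice reduct is distributive; $\mathsf{DLP}$ is the variety of distributive $\ell$-pregroups. Write $x^{\ell^k}$, $x^{r^k}$ for the $k$-fold application of ${}^\ell$, ${}^r$. $\mathbf{F}(\mathbb{Z})$ is the $\ell$-pregroup of all order-preserving maps $f\colon\mathbb{Z}\to\mathbb{Z}$ such that $f^{-1}[\{x\}]$ is finite for every $x\in\mathbb{Z}$, with composition as multiplication, the identity map as $1$, the pointwise order, and $f^{\ell}(q)=\min\{p: q\le f(p)\}$, $f^{r}(q)=\max\{p: f(p)\le q\}$. $\mathbf{F}_n(\mathbb{Z})$ is the subalgebra of all $f$ with $f^{\ell^n}=f^{r^n}$; equivalently, all $f\in \mathbf{F}(\mathbb{Z})$ with $f(x+n)=f(x)+n$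 for all $x\in\mathbb{Z}$. $\mathbb{V}(\mathcal{K})$ denotes the variety generated by $\mathcal{K}$ (so $\mathbb{V}(\emptyset)$ is the trivial variety). $\mathbf{D}=(\mathbb{Z}^+,\mid)$ is the lattice of positive integers ordered by divisibility. $\mathcal{O}_{\mathrm{fin}}(\mathbf{D})$ is the set of its finite downsets (finite sets of positive integers closed under taking divisors, including $\emptyset$), ordered by inclusion. *)

(* Defs.v *)
From HB Require Import structures.
From mathcomp Require Import all_boot all_order all_algebra.
From mathcomp Require Import zify.
From mathcomp Require Import boolp classical_sets functions cardinality.

Set Implicit Arguments.
Unset Strict Implicit.
Unset Printing Implicit Defensive.

#[local] Obligation Tactic := idtac.

Import Order.TTheory GRing.Theory Num.Theory.
Local Open Scope classical_set_scope.
Local Open Scope ring_scope.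

Record algebra : Type := Algebra {
  carrier :> Type;
  ameet : carrier -> carrier -> carrier;
  ajoin : carrier -> carrier -> carrier;
  amul : carrier -> carrier -> carrier;
  aone : carrier;
  aleft : carrier -> carrier;
  aright : carrier -> carrier }.

Arguments aone {a}.

Definition ale (A : algebra) (x y : A) : Prop := ameet x y = x.

Definition is_lpregroup (A : algebra) : Prop :=
  [/\ [/\ commutative (@ameet A), associative (@ameet A)
        & forall x y : A, ameet x (ajoin x y) = x],
      [/\ commutative (@ajoin A), associative (@ajoin A)
        & forall x y : A, ajoin x (ameet x y) = x],
      [/\ associative (@amul A), left_id aone (@amul A)
        & right_id aone (@amul A)],
      (forall x y z : A,
         ale x y -> ale (amul x z) (amul y z) /\ ale (amul z x) (amul z y))
    & forall x : A,
      [/\ ale (amul (aleft x) x) aone, ale aone (amul x (aleft x)),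
          ale (amul x (aright x)) aone & ale aone (amul (aright x) x)]].

Definition DLP : set algebra :=
  [set A | is_lpregroup A /\ left_distributive (@ameet A) (@ajoin A)].

Inductive term : Type :=
  | Var of nat
  | Meet of term & term
  | Join of term & term
  | Mul of term & term
  | One
  | Left of term
  | Right of term.

Fixpoint eval (A : algebra) (v : nat -> A) (t : term) : A :=
  match t with
  | Var i => v i
  | Meet s t => ameet (eval v s) (eval v t)
  | Join s t => ajoin (eval v s) (eval v t)
  | Mul s t => amul (eval v s) (eval v t)
  | One => aone
  | Left t => aleft (eval v t)
  | Right t => aright (eval v t)
  end.

Definition satisfies (A : algebra) (e : term * term) : Prop :=
  forall v : nat -> A, eval v e.1 = eval v e.2.

(* Varieties are equational classes, over countably many variables; by Birkhoff's
   theorem these are the classes closed under H, S and P. *)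
Definition is_variety (V : set algebra) : Prop :=
  exists E : set (term * term),
    V = [set A | forall e, E e -> satisfies A e].

Definition generated_variety (K : set algebra) : set algebra :=
  smallest is_variety K.

Lemma generated_varietyE K :
  generated_variety K =
  [set A | forall e, (forall B, K B -> satisfies B e) -> satisfies A e].
Proof.
apply/seteqP; split=> A /=.
  move=> /(_ [set A | forall e, (forall B, K B -> satisfies B e) ->
                              satisfies A e]) /=; apply; split.
    by exists [set e | forall B, K B -> satisfies B e].
  by move=> B KB e; apply.
move=> hA _ [[E ->] KV] e Ee; apply: hA => B KB.
by have := KV _ KB; apply.
Qed.

Lemma generated_variety_variety K : is_variety (generated_variety K).
Proof.
rewrite generated_varietyE.
by exists [set e | forall B, K B -> satisfies B e].
Qed.

Lemma sub_generated_variety K : K `<=` generated_variety K.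
Proof. exact: sub_smallest. Qed.

Lemma generated_variety_sub K V :
  is_variety V -> K `<=` V -> generated_variety K `<=` V.
Proof. by move=> vV KV A; apply. Qed.

Lemma variety_setI V W : is_variety V -> is_variety W -> is_variety (V `&` W).
Proof.
move=> [E ->] [F ->]; exists (E `|` F); apply/seteqP; split=> A /=.
  by move=> [hE hF] e [/hE|/hF].
by move=> h; split=> e he; apply: h; [left|right].
Qed.

Lemma DLP_variety : is_variety DLP.
Proof.
exists [set e | forall B, DLP B -> satisfies B e].
apply/seteqP; split=> A /=; first by move=> ? e; apply.
move=> hA.
pose v3 (a b c : A) (i : nat) := if i is i.+1 then if i is 0%N then b else c
                                 else a.
have H s t (a b c : A) : (forall B, DLP B -> satisfies B (s, t)) ->
    eval (v3 a b c) s = eval (v3 a b c) t by move=> h; exact: (hA (s, t)).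
set x := Var 0; set y := Var 1; set z := Var 2.
have dl (B : algebra) (a b c : B) : DLP B ->
    [/\ ale (ameet a b) b, ale (amul (ameet a b) c) (amul b c)
      & ale (amul c (ameet a b)) (amul c b)].
  move=> [[[mC mA ab1] [jC jA ab2] _ mon _] _].
  have jid (u : B) : ameet u u = u by rewrite -{2}(ab2 u u) ab1.
  have le : ale (ameet a b) b by rewrite /ale -mA jid.
  by split=> //; have [] := mon _ _ c le.
split; [split; [split|split|split| |move=> a; split] |].
- by move=> a b; apply: (H (Meet x y) (Meet y x) a b a) => B [[[+ _ _]]] _ _ _ _ _ w; apply.
- move=> a b c; apply: (H (Meet x (Meet y z)) (Meet (Meet x y) z) a b c).
  by move=> B [[[_ + _]]] _ _ _ _ _ w; apply.
- move=> a b; apply: (H (Meet x (Join x y)) x a b a).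
  by move=> B [[[_ _ +]]] _ _ _ _ _ w; apply.
- move=> a b; apply: (H (Join x y) (Join y x) a b a).
  by move=> B [[_ [+ _ _]]] _ _ _ _ w; apply.
- move=> a b c; apply: (H (Join x (Join y z)) (Join (Join x y) z) a b c).
  by move=> B [[_ [_ + _]]] _ _ _ _ w; apply.
- move=> a b; apply: (H (Join x (Meet x y)) x a b a).
  by move=> B [[_ [_ _ +]]] _ _ _ _ w; apply.
- move=> a b c; apply: (H (Mul x (Mul y z)) (Mul (Mul x y) z) a b c).
  by move=> B [[_ _ [+ _ _]]] _ _ _ w; apply.
- move=> a; apply: (H (Mul One x) x a a a).
  by move=> B [[_ _ [_ + _]]] _ _ _ w; apply.
- move=> a; apply: (H (Mul x One) x a a a).
  by move=> B [[_ _ [_ _ +]]] _ _ _ w; apply.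
- move=> a b c ab; split.
    rewrite /ale -ab.
    apply: (H (Meet (Mul (Meet x y) z) (Mul y z)) (Mul (Meet x y) z) a b c).
    by move=> B hB w; have [_ + _] := dl B (w 0%N) (w 1%N) (w 2%N) hB; apply.
  rewrite /ale -ab.
  apply: (H (Meet (Mul z (Meet x y)) (Mul z y)) (Mul z (Meet x y)) a b c).
  by move=> B hB w; have [_ _ +] := dl B (w 0%N) (w 1%N) (w 2%N) hB; apply.
- apply: (H (Meet (Mul (Left x) x) One) (Mul (Left x) x) a a a).
  by move=> B [[_ _ _ _ h] _] w; have [+ _ _ _] := h (w 0%N); apply.
- apply: (H (Meet One (Mul x (Left x))) One a a a).
  by move=> B [[_ _ _ _ h] _] w; have [_ + _ _] := h (w 0%N); apply.
- apply: (H (Meet (Mul x (Right x)) One) (Mul x (Right x)) a a a).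
  by move=> B [[_ _ _ _ h] _] w; have [_ _ + _] := h (w 0%N); apply.
- apply: (H (Meet One (Mul (Right x) x)) One a a a).
  by move=> B [[_ _ _ _ h] _] w; have [_ _ _ +] := h (w 0%N); apply.
- move=> a b c; apply: (H (Meet (Join x y) z) (Join (Meet x z) (Meet y z)) a b c).
  by move=> B [_ +] w; apply.
Qed.

Record subvariety : Type := Subvariety {
  subvariety_class :> set algebra;
  subvariety_variety : is_variety subvariety_class;
  subvariety_DLP : subvariety_class `<=` DLP }.

Lemma subvariety_eq (V W : subvariety) : V = W :> set algebra -> V = W.
Proof.
case: V W => V p q [W p' q'] /= e; subst W.
by rewrite (Prop_irrelevance p p') (Prop_irrelevance q q').
Qed.

HB.instance Definition _ := gen_eqMixin subvariety.
HB.instance Definition _ := gen_choiceMixin subvariety.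

Fact subvariety_display : Order.disp_t. Proof. exact: Order.Disp tt tt. Qed.

Section SubvarietyLattice.
Implicit Types U V W : subvariety.

Definition subvariety_le V W : bool := `[< (V : set algebra) `<=` W >].

Fact subvariety_le_refl : reflexive subvariety_le.
Proof. by move=> V; apply/asboolP. Qed.

Fact subvariety_le_anti : antisymmetric subvariety_le.
Proof.
move=> V W /andP[/asboolP VW /asboolP WV].
by apply: subvariety_eq; apply/seteqP.
Qed.

Fact subvariety_le_trans : transitive subvariety_le.
Proof.
move=> W V U /asboolP VW /asboolP WU.
by apply/asboolP; apply: subset_trans WU.
Qed.

Definition generated_subvariety (K : set algebra) (KD : K `<=` DLP) :
  subvariety :=
  Subvariety (generated_variety_variety K)
             (generated_variety_sub DLP_variety KD).

Fact subvariety_meet_subproof V W : (V : set algebra) `&` W `<=` DLP.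
Proof. by move=> A [/subvariety_DLP]. Qed.

Fact subvariety_join_subproof V W : (V : set algebra) `|` W `<=` DLP.
Proof. by move=> A [/subvariety_DLP|/subvariety_DLP]. Qed.

Definition subvariety_meet V W : subvariety :=
  Subvariety (variety_setI (subvariety_variety V) (subvariety_variety W))
             (@subvariety_meet_subproof V W).

Definition subvariety_join V W : subvariety :=
  generated_subvariety (@subvariety_join_subproof V W).

Fact subvariety_meetP U V W :
  subvariety_le U (subvariety_meet V W) =
  subvariety_le U V && subvariety_le U W.
Proof.
apply/asboolP/andP => [h|[/asboolP h /asboolP h']] /=.
  by split; apply/asboolP => A hA; have [] := h A hA.
by move=> A UA; split; [apply: h|apply: h'].
Qed.

Fact subvariety_joinP U V W :
  subvariety_le (subvariety_join U V) W =
  subvariety_le U W && subvariety_le V W.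
Proof.
apply/asboolP/andP => /= [h|[/asboolP h /asboolP h']].
  by split; apply/asboolP => A hA; apply: h; apply: sub_generated_variety; [left|right].
apply: generated_variety_sub; first exact: subvariety_variety.
by move=> A [/h|/h'].
Qed.

End SubvarietyLattice.

HB.instance Definition _ := Order.Le_isPOrder.Build subvariety_display
  subvariety subvariety_le_refl subvariety_le_anti subvariety_le_trans.
HB.instance Definition _ := Order.POrder_MeetJoin_isLattice.Build
  subvariety_display subvariety subvariety_meetP subvariety_joinP.

Record fin_downset : Type := FinDownset {
  downset_set :> set nat;
  downset_finite : finite_set downset_set;
  downset_gt0 : forall k, downset_set k -> (0 < k)%N;
  downset_dvd : forall k d, downset_set k -> (d %| k)%N -> downset_set d }.

Lemma fin_downset_eq (S T : fin_downset) : S = T :> set nat -> S = T.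
Proof.
case: S T => S p q r [T p' q' r'] /= e; subst T.
by rewrite (Prop_irrelevance p p') (Prop_irrelevance q q')
           (Prop_irrelevance r r').
Qed.

HB.instance Definition _ := gen_eqMixin fin_downset.
HB.instance Definition _ := gen_choiceMixin fin_downset.

Fact fin_downset_display : Order.disp_t. Proof. exact: Order.Disp tt tt. Qed.

Section DownsetLattice.
Implicit Types S T U : fin_downset.

Definition fin_downset_le S T : bool := `[< (S : set nat) `<=` T >].

Fact fin_downset_le_refl : reflexive fin_downset_le.
Proof. by move=> S; apply/asboolP. Qed.

Fact fin_downset_le_anti : antisymmetric fin_downset_le.
Proof.
move=> S T /andP[/asboolP ST /asboolP TS].
by apply: fin_downset_eq; apply/seteqP.
Qed.

Fact fin_downset_le_trans : transitive fin_downset_le.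
Proof.
move=> T S U /asboolP ST /asboolP TU.
by apply/asboolP; apply: subset_trans TU.
Qed.

Program Definition fin_downset_meet S T : fin_downset :=
  @FinDownset ((S : set nat) `&` T) _ _ _.
Next Obligation. by move=> S T; apply: finite_setIl; exact: downset_finite. Qed.
Next Obligation. by move=> S T k [/downset_gt0]. Qed.
Next Obligation.
by move=> S T k d [Sk Tk] dk; split; apply: downset_dvd dk.
Qed.

Program Definition fin_downset_join S T : fin_downset :=
  @FinDownset ((S : set nat) `|` T) _ _ _.
Next Obligation.
by move=> S T; rewrite finite_setU; split; exact: downset_finite.
Qed.
Next Obligation. by move=> S T k [/downset_gt0|/downset_gt0]. Qed.
Next Obligation.
by move=> S T k d [Sk|Tk] dk; [left|right]; apply: downset_dvd dk.
Qed.

Fact fin_downset_meetP S T U :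
  fin_downset_le S (fin_downset_meet T U) =
  fin_downset_le S T && fin_downset_le S U.
Proof.
apply/asboolP/andP => [h|[/asboolP h /asboolP h']] /=.
  by split; apply/asboolP => A hA; have [] := h A hA.
by move=> A UA; split; [apply: h|apply: h'].
Qed.

Fact fin_downset_joinP S T U :
  fin_downset_le (fin_downset_join S T) U =
  fin_downset_le S U && fin_downset_le T U.
Proof.
apply/asboolP/andP => /= [h|[/asboolP h /asboolP h']].
  by split; apply/asboolP => A hA; apply/h; [left|right].
by move=> A [/h|/h'].
Qed.

End DownsetLattice.

HB.instance Definition _ := Order.Le_isPOrder.Build fin_downset_display
  fin_downset fin_downset_le_refl fin_downset_le_anti fin_downset_le_trans.
HB.instance Definition _ := Order.POrder_MeetJoin_isLattice.Build
  fin_downset_display fin_downset fin_downset_meetP fin_downset_joinP.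

Definition lattice_ideal d (L : latticeType d) (I : set L) : Prop :=
  [/\ I !=set0,
      (forall x y : L, I y -> (x <= y)%O -> I x)
    & (forall x y : L, I x -> I y -> I (x `|` y)%O)].

(* [I] is meant to be a sublattice of [L] (for instance an ideal), so that its
   lattice operations are those of [L]. *)
Definition lattice_iso_onto d d' (M : latticeType d) (L : latticeType d')
    (f : M -> L) (I : set L) : Prop :=
  [/\ set_bij [set: M] I f,
      {morph f : x y / (x `&` y)%O >-> (x `&` y)%O}
    & {morph f : x y / (x `|` y)%O >-> (x `|` y)%O}].

Record FZ : Type := MkFZ {
  FZ_fun :> int -> int;
  FZ_homo : {homo FZ_fun : x y / x <= y};
  FZ_finite : forall x, finite_set (FZ_fun @^-1` [set x]) }.

Lemma FZ_eq (f g : FZ) : f =1 g -> f = g.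
Proof.
case: f g => f p q [g p' q'] /= /funext e; subst g.
by rewrite (Prop_irrelevance p p') (Prop_irrelevance q q').
Qed.

(* The default value 0 is returned when there is no least (greatest) element;
   see [zminP], [zmaxP]. *)
Definition zmin (P : set int) : int :=
  xget 0 [set m | P m /\ forall p, P p -> m <= p].
Definition zmax (P : set int) : int :=
  xget 0 [set m | P m /\ forall p, P p -> p <= m].

Lemma zminP (P : set int) (b : int) : P !=set0 -> (forall p, P p -> b <= p) ->
  P (zmin P) /\ forall p, P p -> zmin P <= p.
Proof.
move=> [x Px] bP.
suff [m hm] : exists m, P m /\ forall p, P p -> m <= p.
  have h : exists k, [set m | P m /\ forall p, P p -> m <= p] k by exists m.
  exact: (xgetPex 0 h).
have ex : exists n : nat, `[< P (b + n%:Z) >].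
  exists (absz (x - b)); apply/asboolP.
  have bx := bP _ Px.
  by have -> : b + (absz (x - b))%:Z = x by lia.
have [n /asboolP Pn nmin] := ex_minnP ex.
exists (b + n%:Z); split=> // p Pp.
have bp := bP _ Pp.
have : (n <= absz (p - b))%N.
  apply: nmin; apply/asboolP.
  by have -> : b + (absz (p - b))%:Z = p by lia.
by lia.
Qed.

Lemma zmaxP (P : set int) (b : int) : P !=set0 -> (forall p, P p -> p <= b) ->
  P (zmax P) /\ forall p, P p -> p <= zmax P.
Proof.
move=> [x Px] bP.
suff [m hm] : exists m, P m /\ forall p, P p -> p <= m.
  have h : exists k, [set m | P m /\ forall p, P p -> p <= m] k by exists m.
  exact: (xgetPex 0 h).
have ex : exists n : nat, `[< P (b - n%:Z) >].
  exists (absz (b - x)); apply/asboolP.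
  have bx := bP _ Px.
  by have -> : b - (absz (b - x))%:Z = x by lia.
have [n /asboolP Pn nmin] := ex_minnP ex.
exists (b - n%:Z); split=> // p Pp.
have bp := bP _ Pp.
have : (n <= absz (b - p))%N.
  apply: nmin; apply/asboolP.
  by have -> : b - (absz (b - p))%:Z = p by lia.
by lia.
Qed.

Lemma finite_int_bounded (A : set int) : finite_set A ->
  exists M : int, forall p, A p -> - M < p < M.
Proof.
move=> /finite_seqP[s ->].
suff [M [M0 hM]] : exists M : int, 0 <= M /\ forall p, p \in s -> - M < p < M.
  by exists M.
elim: s => [|a s [M [M0 hM]]]; first by exists 0.
exists (M + `|a| + 1); split; first by lia.
by move=> p; rewrite inE => /orP[/eqP ->|/hM]; lia.
Qed.

Lemma bounded_int_finite (A : set int) (a b : int) :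
  (forall p, A p -> a < p < b) -> finite_set A.
Proof.
move=> h; apply: (@sub_finite_set _ _
    [set` [seq a + n%:Z | n <- iota 0 (absz (b - a))]]); last first.
  exact: finite_seq.
move=> p Ap /=; have ab := h _ Ap.
apply/mapP; exists (absz (p - a)); last by lia.
by rewrite mem_iota; lia.
Qed.

(* A monotone map has finite fibres iff it is unbounded in both directions. *)
Lemma FZ_above (f : FZ) (q : int) : exists p, q <= f p.
Proof.
have step p : exists p', f p < f p'.
  have [M hM] := finite_int_bounded (FZ_finite f (f p)).
  exists (Num.max p M).
  have le : f p <= f (Num.max p M) by apply: FZ_homo; rewrite le_max lexx.
  rewrite lt_neqAle le andbT; apply/eqP => e.
  by have := hM (Num.max p M) (esym e); lia.
have [c ec] : exists c, c = f 0 by exists (f 0).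
suff h (n : nat) : exists p, c + n%:Z <= f p.
  by have [p hp] := h (absz (q - c)); exists p; lia.
elim: n => [|n [p hp]]; first by exists 0; rewrite ec; lia.
by have [p' hp'] := step p; exists p'; lia.
Qed.

Lemma FZ_below (f : FZ) (q : int) : exists p, f p <= q.
Proof.
have step p : exists p', f p' < f p.
  have [M hM] := finite_int_bounded (FZ_finite f (f p)).
  exists (Num.min p (- M)).
  have le : f (Num.min p (- M)) <= f p by apply: FZ_homo; rewrite ge_min lexx.
  rewrite lt_neqAle le andbT; apply/eqP => e.
  by have := hM (Num.min p (- M)) e; lia.
have [c ec] : exists c, c = f 0 by exists (f 0).
suff h (n : nat) : exists p, f p <= c - n%:Z.
  by have [p hp] := h (absz (q - c)); exists p; lia.
elim: n => [|n [p hp]]; first by exists 0; rewrite ec; lia.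
by have [p' hp'] := step p; exists p'; lia.
Qed.

Lemma unbounded_finite (f : int -> int) : {homo f : x y / x <= y} ->
  (forall q, exists p, q <= f p) -> (forall q, exists p, f p <= q) ->
  forall x, finite_set (f @^-1` [set x]).
Proof.
move=> hf ha hb x.
have [b fb] := ha (x + 1); have [a fa] := hb (x - 1).
apply: (@bounded_int_finite _ a b) => p /= fp.
have [//|ap] := boolP (a < p); last by have := hf p a; lia.
by have [//|pb] := boolP (p < b); have := hf b p; lia.
Qed.

Definition left_fun (f : int -> int) (q : int) : int := zmin [set p | q <= f p].
Definition right_fun (f : int -> int) (q : int) : int := zmax [set p | f p <= q].

Lemma left_funP (f : FZ) q p : (left_fun f q <= p) = (q <= f p).
Proof.
have [b fb] := FZ_below f (q - 1).
have lo p' : [set p | q <= f p] p' -> b <= p'.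
  by move=> /= h; have [//|pb] := boolP (b <= p'); have := @FZ_homo f p' b; lia.
have [h1 h2] := zminP (FZ_above f q) lo.
apply/idP/idP => [h|]; last exact: h2.
by apply: le_trans h1 _; exact: FZ_homo.
Qed.

Lemma right_funP (f : FZ) q p : (p <= right_fun f q) = (f p <= q).
Proof.
have [b fb] := FZ_above f (q + 1).
have up p' : [set p | f p <= q] p' -> p' <= b.
  by move=> /= h; have [//|pb] := boolP (p' <= b); have := @FZ_homo f b p'; lia.
have [h1 h2] := zmaxP (FZ_below f q) up.
apply/idP/idP => [h|]; last exact: h2.
by apply: le_trans h1; exact: FZ_homo.
Qed.

Program Definition FZ_meet (f g : FZ) : FZ :=
  @MkFZ (fun x => Num.min (f x) (g x)) _ _.
Next Obligation.
by move=> f g x y xy; have := @FZ_homo f _ _ xy; have := @FZ_homo g _ _ xy; lia.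
Qed.
Next Obligation.
move=> f g; apply: unbounded_finite; first exact: FZ_meet_obligation_1.
  move=> q; have [a fa] := FZ_above f q; have [b gb] := FZ_above g q.
  exists (Num.max a b).
  have := @FZ_homo f a (Num.max a b); have := @FZ_homo g b (Num.max a b); lia.
by move=> q; have [a fa] := FZ_below f q; exists a; lia.
Qed.

Program Definition FZ_join (f g : FZ) : FZ :=
  @MkFZ (fun x => Num.max (f x) (g x)) _ _.
Next Obligation.
by move=> f g x y xy; have := @FZ_homo f _ _ xy; have := @FZ_homo g _ _ xy; lia.
Qed.
Next Obligation.
move=> f g; apply: unbounded_finite; first exact: FZ_join_obligation_1.
  by move=> q; have [a fa] := FZ_above f q; exists a; lia.
move=> q; have [a fa] := FZ_below f q; have [b gb] := FZ_below g q.
exists (Num.min a b).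
have := @FZ_homo f (Num.min a b) a; have := @FZ_homo g (Num.min a b) b; lia.
Qed.

Program Definition FZ_mul (f g : FZ) : FZ := @MkFZ (f \o g) _ _.
Next Obligation. by move=> f g x y xy /=; do 2 apply: FZ_homo. Qed.
Next Obligation.
move=> f g; apply: unbounded_finite; first exact: FZ_mul_obligation_1.
  move=> q; have [a fa] := FZ_above f q; have [b gb] := FZ_above g a.
  by exists b; apply: (le_trans fa); apply: FZ_homo.
move=> q; have [a fa] := FZ_below f q; have [b gb] := FZ_below g a.
by exists b; apply: le_trans fa; apply: FZ_homo.
Qed.

Program Definition FZ_one : FZ := @MkFZ id _ _.
Next Obligation. by []. Qed.
Next Obligation. by apply: unbounded_finite => // q; exists q. Qed.

Program Definition FZ_left (f : FZ) : FZ := @MkFZ (left_fun f) _ _.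
Next Obligation.
move=> f x y xy; rewrite left_funP; apply: (le_trans xy).
by rewrite -left_funP.
Qed.
Next Obligation.
move=> f; apply: unbounded_finite; first exact: FZ_left_obligation_1.
  by move=> q; exists (f (q - 1) + 1); have := left_funP f (f (q - 1) + 1) (q - 1); lia.
by move=> q; exists (f q); rewrite left_funP.
Qed.

Program Definition FZ_right (f : FZ) : FZ := @MkFZ (right_fun f) _ _.
Next Obligation.
move=> f x y xy; rewrite right_funP; apply: le_trans xy.
by rewrite -right_funP.
Qed.
Next Obligation.
move=> f; apply: unbounded_finite; first exact: FZ_right_obligation_1.
  by move=> q; exists (f q); rewrite right_funP.
by move=> q; exists (f (q + 1) - 1); have := right_funP f (f (q + 1) - 1) (q + 1); lia.
Qed.

Definition F_Z : algebra :=
  @Algebra FZ FZ_meet FZ_join FZ_mul FZ_one FZ_left FZ_right.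

Lemma F_Z_DLP : DLP F_Z.
Proof.
have leP (f g : F_Z) : (forall x, (f : FZ) x <= (g : FZ) x) -> ale f g.
  by move=> h; apply: FZ_eq => x /=; have := h x; lia.
have geP (f g : F_Z) x : ale f g -> (f : FZ) x <= (g : FZ) x.
  by move=> h; have := congr1 (fun f : FZ => f x) h => /=; lia.
split; [split; [split|split|split| |move=> f; split] |];
  try by move=> *; apply: FZ_eq => ? /=; lia.
- move=> f g h fg; split; apply: leP => u /=; first exact: geP.
  by apply: FZ_homo; apply: geP.
- by apply: leP => u /=; rewrite left_funP.
- by apply: leP => u /=; rewrite -left_funP.
- by apply: leP => u /=; rewrite -right_funP.
- by apply: leP => u /=; rewrite right_funP.
Qed.

Record subuniverse (A : algebra) (P : set A) : Prop := Subuniverse {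
  sub_meet : forall x y, P x -> P y -> P (ameet x y);
  sub_join : forall x y, P x -> P y -> P (ajoin x y);
  sub_mul : forall x y, P x -> P y -> P (amul x y);
  sub_one : P aone;
  sub_left : forall x, P x -> P (aleft x);
  sub_right : forall x, P x -> P (aright x) }.

Definition subalgebra (A : algebra) (P : set A) (hP : subuniverse P) : algebra :=
  @Algebra {x : A | P x}
    (fun x y => exist _ _ (sub_meet hP (svalP x) (svalP y)))
    (fun x y => exist _ _ (sub_join hP (svalP x) (svalP y)))
    (fun x y => exist _ _ (sub_mul hP (svalP x) (svalP y)))
    (exist _ _ (sub_one hP))
    (fun x => exist _ _ (sub_left hP (svalP x)))
    (fun x => exist _ _ (sub_right hP (svalP x))).

Lemma subalgebra_variety (V : set algebra) (A : algebra) (P : set A)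
  (hP : subuniverse P) : is_variety V -> V A -> V (subalgebra hP).
Proof.
move=> [E ->] /= hA e Ee v.
have ev t : sval (eval v t) = eval (fun i => sval (v i)) t.
  by elim: t => //= [s -> t ->|s -> t ->|s -> t ->|t ->|t ->].
have := hA e Ee (fun i => sval (v i)); rewrite -!ev.
by case: (eval v e.1) (eval v e.2) => x p [y q] /= xy; apply: eq_exist.
Qed.

(* Meant for 0 < n: with n = 0 the condition is void. *)
Definition F_n_set (n : nat) : set F_Z :=
  [set f | iter n (@aleft F_Z) f = iter n (@aright F_Z) f].

Lemma le_inj (a b : int) : (forall p, (a <= p) = (b <= p)) -> a = b.
Proof. by move=> h; apply/eqP; rewrite eq_le h lexx -h lexx. Qed.

Lemma ge_inj (a b : int) : (forall p, (p <= a) = (p <= b)) -> a = b.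
Proof. by move=> h; apply/eqP; rewrite eq_le -h lexx h lexx. Qed.

Lemma F_n_subuniverse n : subuniverse (F_n_set n).
Proof.
have lM (f g : FZ) : FZ_left (FZ_mul f g) = FZ_mul (FZ_left g) (FZ_left f).
  by apply: FZ_eq => q; apply: le_inj => p; rewrite !left_funP.
have rM (f g : FZ) : FZ_right (FZ_mul f g) = FZ_mul (FZ_right g) (FZ_right f).
  by apply: FZ_eq => q; apply: ge_inj => p; rewrite !right_funP.
have lI (f g : FZ) : FZ_left (FZ_meet f g) = FZ_join (FZ_left f) (FZ_left g).
  by apply: FZ_eq => q; apply: le_inj => p; rewrite !left_funP /= ge_max
    le_min !left_funP.
have rI (f g : FZ) : FZ_right (FZ_meet f g) = FZ_join (FZ_right f) (FZ_right g).
  by apply: FZ_eq => q; apply: ge_inj => p; rewrite !right_funP /= ge_min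
    le_max !right_funP.
have lU (f g : FZ) : FZ_left (FZ_join f g) = FZ_meet (FZ_left f) (FZ_left g).
  by apply: FZ_eq => q; apply: le_inj => p; rewrite !left_funP /= ge_min
    le_max !left_funP.
have rU (f g : FZ) : FZ_right (FZ_join f g) = FZ_meet (FZ_right f) (FZ_right g).
  by apply: FZ_eq => q; apply: ge_inj => p; rewrite !right_funP /= ge_max
    le_min !right_funP.
have lr (f : FZ) : FZ_right (FZ_left f) = f.
  by apply: FZ_eq => q; apply: ge_inj => p; rewrite right_funP left_funP.
have rl (f : FZ) : FZ_left (FZ_right f) = f.
  by apply: FZ_eq => q; apply: le_inj => p; rewrite left_funP right_funP.
have l1 : FZ_left FZ_one = FZ_one.
  by apply: FZ_eq => q; apply: le_inj => p; rewrite left_funP.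
have r1 : FZ_right FZ_one = FZ_one.
  by apply: FZ_eq => q; apply: ge_inj => p; rewrite right_funP.
have iM (op : FZ -> FZ) (h : forall f g, op (FZ_mul f g) = FZ_mul (op g) (op f))
    f g m : iter m op (FZ_mul f g) =
    if odd m then FZ_mul (iter m op g) (iter m op f)
    else FZ_mul (iter m op f) (iter m op g).
  by elim: m => //= m ->; case: (odd m); rewrite /= h.
have iI (op : FZ -> FZ) (h : forall f g, op (FZ_meet f g) = FZ_join (op f) (op g))
    (h' : forall f g, op (FZ_join f g) = FZ_meet (op f) (op g)) f g m :
    iter m op (FZ_meet f g) =
    if odd m then FZ_join (iter m op f) (iter m op g)
    else FZ_meet (iter m op f) (iter m op g).
  by elim: m => //= m ->; case: (odd m); rewrite /= ?h ?h'.
have iU (op : FZ -> FZ) (h : forall f g, op (FZ_meet f g) = FZ_join (op f) (op g))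
    (h' : forall f g, op (FZ_join f g) = FZ_meet (op f) (op g)) f g m :
    iter m op (FZ_join f g) =
    if odd m then FZ_meet (iter m op f) (iter m op g)
    else FZ_join (iter m op f) (iter m op g).
  by elim: m => //= m ->; case: (odd m); rewrite /= ?h ?h'.
have i1 (op : FZ -> FZ) m : op FZ_one = FZ_one -> iter m op FZ_one = FZ_one.
  by move=> h; elim: m => //= m ->.
rewrite /F_n_set; split=> /=.
- by move=> f g ef eg; rewrite !iI // ef eg.
- by move=> f g ef eg; rewrite !iU // ef eg.
- by move=> f g ef eg; rewrite !iM // ef eg.
- by rewrite !i1.
- case: n => [//|m] f ef.
  by rewrite -[LHS]iterSr [LHS]iterS ef [RHS]iterSr lr /= rl.
- case: n => [//|m] f ef.
  by rewrite -[RHS]iterSr [RHS]iterS -ef [LHS]iterSr rl /= lr.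
Qed.

Definition F_n (n : nat) : algebra := subalgebra (F_n_subuniverse n).

Lemma F_n_DLP n : DLP (F_n n).
Proof. exact: subalgebra_variety DLP_variety F_Z_DLP. Qed.

Fact F_image_DLP (S : set nat) : F_n @` S `<=` DLP.
Proof. by move=> _ [k _ <-]; exact: F_n_DLP. Qed.

Definition downset_subvariety (S : fin_downset) : subvariety :=
  generated_subvariety (@F_image_DLP S).

Definition finitely_F_generated : set subvariety :=
  [set V | exists K : set algebra,
     [/\ finite_set K, K `<=` F_n @` [set n | (0 < n)%N]
       & V = generated_variety K :> set algebra]].

(* Main.v *)
Require Import Defs.
From mathcomp Require Import all_boot all_order all_algebra.
From mathcomp Require Import zify.
From mathcomp Require Import boolp classical_sets functions cardinality.

(** Everything is computed inside [F_Z]: [F_n] consists of the maps with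
    [f (x + n) = f x + n] ([F_n_setP]), so an equation holds in [F_n] iff it
    holds in [F_Z] for all [n]-periodic assignments ([satisfies_F_n]).  In
    particular [F_d] embeds in [F_n] when [d] divides [n], and any finite set
    of the [F_k] generates a subvariety of that of a single [F_n].

    The algebras [F_n] carry a term-definable distance.  Since [f^ll] is the
    conjugate of [f] by the translation by 1, the meet of [n] such conjugates
    of an [n]-periodic [f] is invariant under conjugation, hence a translation;
    applied to the product of the meet of [f] and [g] with the left adjoint of
    their join, it yields the translation by minus the maximum of [|f - g|]
    ([gapP]).  Inequalities between distances are thus equations, and an
    algebra [A] in the variety of [F_n] inherits them.  Consequently, if [A]
    satisfies finitely many equations whose distances in [F_n] jointly bound
    that of [e], up to a constant factor, then [A] satisfies [e]
    ([satisfies_of_gap_bound]).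

    The heart of the matter is a description of the subuniverses of [F_n]: one
    that contains more than translations is exactly the set of all
    [k]-periodic maps, for some [k] dividing [n] ([subuniverse_periodic]).

    Let then [A] be in the variety of [F_n], and let [e] fail in [A].  Some
    [F_k] with [k] dividing [n] lies in the variety of [A] and refutes [e]
    ([failure_at_divisor]).  Indeed, suppose not.  If [F_1] is not in the
    variety of [A], an equation of [A] that fails in [F_1] fails there by an
    amount proportional to any prescribed translation, in particular to the
    distance of [e], so that [A] satisfies [e].  If [F_1] is, then it satisfies
    [e], and as an assignment in [F_n] is within distance [n] of an assignment
    of translations, the distance of [e] is bounded.  Moreover, wherever [e]
    fails, the values of the variables generate all of some [F_k] that refutes
    [e], hence refutes an equation of [A]; the elements that refute it are
    values of terms.  Up to translations there are only finitely many
    assignments, so finitely many equations of [A] are enough to bound the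
    distance of [e].

    It follows that each subvariety of the variety of [F_n] is generated by
    those [F_k], with [k] dividing [n], that it contains.  This gives the ideal
    and the surjectivity.  That the map reflects the order is the fact that,
    when [k] divides no element of a finite set [T], the equation saying that
    one of the [x^(l^2m) = x], for [m] in [T], holds (a join of gaps is the
    identity) is true in all [F_m] and false in [F_k]
    ([separating_equation]). *)

Set Implicit Arguments.
Unset Strict Implicit.
Unset Printing Implicit Defensive.

#[local] Obligation Tactic := idtac.

Import Order.TTheory GRing.Theory Num.Theory.
Local Open Scope classical_set_scope.
Local Open Scope ring_scope.

(** * Terms and substitution *)

(** Terms form an algebra, so that one definition of a derived operation serves
    both as a term and as its interpretation. *)
Definition term_algebra : algebra := @Algebra term Meet Join Mul One Left Right.

Definition subst (w : nat -> term) (t : term) : term := @eval term_algebra w t.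

Lemma eval_subst (A : algebra) (v : nat -> A) w t :
  eval v (subst w t) = eval (fun i => eval v (w i)) t.
Proof.
by rewrite /subst; elim: t => //=
  [s -> t ->|s -> t ->|s -> t ->|t ->|t ->].
Qed.

Lemma eval_mem (A : algebra) (P : set A) (v : nat -> A) t :
  subuniverse P -> (forall i, P (v i)) -> P (eval v t).
Proof.
move=> hP hv; elim: t => /=.
- exact: hv.
- by move=> s hs t ht; apply: sub_meet.
- by move=> s hs t ht; apply: sub_join.
- by move=> s hs t ht; apply: sub_mul.
- exact: sub_one.
- by move=> t ht; apply: sub_left.
- by move=> t ht; apply: sub_right.
Qed.

Lemma eval_subuniverse (A : algebra) (v : nat -> A) :
  subuniverse [set x | exists t, eval v t = x].
Proof.
split.
- by move=> _ _ [s <-] [t <-]; exists (Meet s t).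
- by move=> _ _ [s <-] [t <-]; exists (Join s t).
- by move=> _ _ [s <-] [t <-]; exists (Mul s t).
- by exists One.
- by move=> _ [s <-]; exists (Left s).
- by move=> _ [s <-]; exists (Right s).
Qed.

Fixpoint var_bound (t : term) : nat :=
  match t with
  | Var i => i.+1
  | Meet s t | Join s t | Mul s t => maxn (var_bound s) (var_bound t)
  | One => 0
  | Left t | Right t => var_bound t
  end.

Lemma eval_ext (A : algebra) (v w : nat -> A) t :
  (forall i, (i < var_bound t)%N -> v i = w i) -> eval v t = eval w t.
Proof.
elim: t => //=; try (by move=> t IH h; rewrite IH); try (move=> s IHs t IHt h;
  by rewrite IHs ?IHt // => i hi; apply: h; rewrite leq_max hi ?orbT).
by move=> i h; apply: h.
Qed.

(** * Distances as terms *)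

(** In [F_Z], [x^(l^2i)] is the conjugate of [x] by the translation by [i], so this
    meet is invariant under conjugation when [x] has period [n]. *)
Definition orbit_meet (A : algebra) (n : nat) (x : A) : A :=
  foldr (fun i y => ameet (iter i.*2 (@aleft A) x) y) x (iota 0 n).

(** In [F_n] this will be the translation by minus the maximum of [|x - y|]. *)
Definition gap (A : algebra) (n : nat) (x y : A) : A :=
  orbit_meet n (amul (ameet x y) (aleft (ajoin x y))).

Lemma eval_orbit_meet (A : algebra) (v : nat -> A) n (t : term_algebra) :
  eval v (orbit_meet n t) = orbit_meet n (eval v t).
Proof.
rewrite /orbit_meet; elim: (iota 0 n) => //= i s ->; congr ameet.
by elim: i => // i IH; rewrite doubleS !iterS -IH.
Qed.

Lemma eval_gap (A : algebra) (v : nat -> A) n (s t : term_algebra) :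
  eval v (gap n s t) = gap n (eval v s) (eval v t).
Proof. by rewrite /gap eval_orbit_meet. Qed.

(** * Translations and conjugation in F(Z) *)

Lemma int_le_inj (a b : int) : (forall p : int, (a <= p) = (b <= p)) -> a = b.
Proof. exact: le_inj. Qed.

Lemma int_ge_inj (a b : int) : (forall p : int, (p <= a) = (p <= b)) -> a = b.
Proof. exact: ge_inj. Qed.

Program Definition translation (c : int) : FZ := @MkFZ (fun x => x + c) _ _.
Next Obligation. by move=> c x y xy; rewrite lerD2r. Qed.
Next Obligation.
move=> c; apply: unbounded_finite; first by move=> x y xy; rewrite lerD2r.
  by move=> q; exists (q - c); rewrite subrK.
by move=> q; exists (q - c); rewrite subrK.
Qed.

Definition conjugate (i : int) (f : FZ) : FZ :=
  FZ_mul (translation i) (FZ_mul f (translation (- i))).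

(** A strict inequality over the integers is a weak one shifted by 1; this is why
    two steps of adjunction come back to [f] conjugated by a shift. *)
Lemma FZ_left2 f : FZ_left (FZ_left f) = conjugate 1 f.
Proof.
apply: FZ_eq => q; have [r ->] : exists r : int, q = r + 1.
  by exists (q - 1); rewrite subrK.
apply: int_le_inj => p; rewrite [RHS]/= addrK.
have := left_funP (FZ_left f) (r + 1) p; have := left_funP f p r.
by rewrite /=; lia.
Qed.

Lemma FZ_right2 f : FZ_right (FZ_right f) = conjugate (-1) f.
Proof.
apply: FZ_eq => q; have [r ->] : exists r : int, q = r - 1.
  by exists (q + 1); rewrite addrK.
apply: int_ge_inj => p; rewrite [RHS]/= opprK subrK.
have := right_funP (FZ_right f) (r - 1) p; have := right_funP f p r.
by rewrite /=; lia.
Qed.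

Lemma FZ_leftK : cancel FZ_left FZ_right.
Proof.
by move=> f; apply: FZ_eq => q; apply: int_ge_inj => p; rewrite right_funP left_funP.
Qed.

Lemma FZ_rightK : cancel FZ_right FZ_left.
Proof.
by move=> f; apply: FZ_eq => q; apply: int_le_inj => p; rewrite left_funP right_funP.
Qed.

Lemma FZ_left_translation c : FZ_left (translation c) = translation (- c).
Proof. by apply: FZ_eq => q; apply: int_le_inj => p; rewrite left_funP /=; lia. Qed.

Lemma FZ_right_translation c : FZ_right (translation c) = translation (- c).
Proof. by apply: FZ_eq => q; apply: int_ge_inj => p; rewrite right_funP /=; lia. Qed.

Lemma iter_left2 (i : nat) f : iter i.*2 FZ_left f = conjugate i f.
Proof.
elim: i => [|i IH].
  by apply: FZ_eq => x /=; rewrite addr0 oppr0 addr0.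
rewrite doubleS !iterS IH FZ_left2; apply: FZ_eq => x /=.
by have -> : x - 1 - i%:Z = x - i.+1%:Z; lia.
Qed.

(** * Periodic maps and equations *)

Definition periodic (n : nat) (f : FZ) : Prop :=
  forall x : int, f (x + n%:Z) = f x + n%:Z.

(** The condition [f^(l^n) = f^(r^n)] amounts to [f^(l^2n) = f], and [f^(l^2n)] is
    the conjugate of [f] by the translation by [n]. *)
Lemma F_n_setP n f : F_n_set n f <-> periodic n f.
Proof.
have -> : periodic n f <-> conjugate n f = f.
  split=> [h|h x]; last by rewrite -{1}h /= addrK.
  by apply: FZ_eq => x /=; rewrite -h subrK.
have lrK g : iter n FZ_left (iter n FZ_right g) = g.
  by elim: n g => // n IH g; rewrite iterSr iterS FZ_rightK IH.
have rlK g : iter n FZ_right (iter n FZ_left g) = g.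
  by elim: n g {lrK} => // n IH g; rewrite iterSr iterS FZ_leftK IH.
rewrite -iter_left2 -addnn iterD /F_n_set /=; split=> [->|h]; first exact: lrK.
by rewrite -[in RHS]h rlK.
Qed.

Lemma periodic_mulr n f (j x : int) :
  periodic n f -> f (x + j * n%:Z) = f x + j * n%:Z.
Proof.
move=> h; have pos (i : nat) y : f (y + i%:Z * n%:Z) = f y + i%:Z * n%:Z.
  elim: i => [|i IH]; first by rewrite !mul0r !addr0.
  by rewrite -addn1 PoszD mulrDl mul1r !addrA h IH.
case: j => i; first exact: pos.
rewrite NegzE !mulNr; have := pos i.+1 (x - i.+1%:Z * n%:Z); rewrite subrK => ->.
by rewrite addrK.
Qed.

Lemma periodic_dvd d n f : (d %| n)%N -> periodic d f -> periodic n f.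
Proof.
move=> /dvdnP[q ->] h x; rewrite PoszM; exact: periodic_mulr.
Qed.

Lemma periodic_subuniverse n : @subuniverse F_Z (periodic n).
Proof.
have -> : periodic n = F_n_set n; last exact: F_n_subuniverse.
by apply/funext => f; apply/propext; rewrite F_n_setP.
Qed.

Lemma periodic1P f : periodic 1 f <-> exists c, f = translation c.
Proof.
split=> [h|[c ->] x /=]; last by lia.
exists (f 0); apply: FZ_eq => x /=.
by have := periodic_mulr x 0 h; rewrite mulr1 add0r addrC => ->.
Qed.

Lemma translation_periodic n c : periodic n (translation c).
Proof. by move=> x /=; lia. Qed.

Notation evalZ v t := (@eval F_Z v t : FZ).

Definition F_satisfies (n : nat) (e : term * term) : Prop :=
  forall v : nat -> FZ, (forall i, periodic n (v i)) ->
    evalZ v e.1 = evalZ v e.2.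

Lemma satisfies_F_n n e : satisfies (F_n n) e <-> F_satisfies n e.
Proof.
have ev (v : nat -> F_n n) t : sval (eval v t) = evalZ (fun i => sval (v i)) t.
  by elim: t => //= [s -> t ->|s -> t ->|s -> t ->|t ->|t ->].
split=> [h v hv|h v].
  have hv' i : F_n_set n (v i) by apply/F_n_setP.
  have := congr1 sval (h (fun i => exist (F_n_set n) (v i) (hv' i))).
  by rewrite !ev.
have : sval (eval v e.1) = sval (eval v e.2).
  by rewrite !ev; apply: h => i; apply/F_n_setP; exact: svalP.
case: (eval v e.1) (eval v e.2) => x p [y q] /= xy; exact: eq_exist.
Qed.

Lemma F_satisfies_dvd d n e : (d %| n)%N -> F_satisfies n e -> F_satisfies d e.
Proof. by move=> dn h v hv; apply: h => i; apply: periodic_dvd (hv i). Qed.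

Lemma periodic_eval n v t : (forall i, periodic n (v i)) -> periodic n (evalZ v t).
Proof. by move=> hv; apply: eval_mem => //; apply: periodic_subuniverse. Qed.

Lemma int_residue (n : nat) (a x : int) : (0 < n)%N ->
  exists (r : nat) (q : int), (r < n)%N /\ x = a + r%:Z + q * n%:Z.
Proof.
move=> n0; exists (absz ((x - a) %% n)%Z), ((x - a) %/ n)%Z.
have n0' : n%:Z != 0 by lia.
have ge0 := modz_ge0 (x - a) n0'; have lt := ltz_pmod (x - a) (n0 : 0 < n%:Z).
split; first by lia.
by have := divz_eq (x - a) n%:Z; lia.
Qed.

(** Over a full period of conjugates, the value at [x] is the minimum over all
    integers [y] of [f y + (x - y)], which is [x] plus the least displacement. *)
Lemma orbit_meetP n f : (0 < n)%N -> periodic n f ->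
  exists c, [/\ orbit_meet n (f : F_Z) = translation c,
    forall x : int, x + c <= f x & exists x : int, f x = x + c].
Proof.
move=> n0 pf.
pose m (l : seq nat) : FZ :=
  foldr (fun i y => @ameet F_Z (iter i.*2 FZ_left f) y) f l.
have lb l x i : i \in l -> m l x <= f (x - i%:Z) + i%:Z.
  elim: l => //= j l IH; rewrite inE iter_left2 => /orP[/eqP ->|/IH h] /=.
    by rewrite ge_min lexx.
  by rewrite ge_min h orbT.
have att l x : exists y : int, m l x = f y + (x - y).
  elim: l => [|j l [y IH]] /=; first by exists x; rewrite subrr addr0.
  rewrite iter_left2 /=; have [le|le] := leP (f (x - j%:Z) + j) (m l x).
    by exists (x - j%:Z); rewrite subKr.
  by exists y.
have glb x y : m (iota 0 n) x <= f y + (x - y).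
  have [r [q [rn xy]]] := int_residue 0 (x - y) n0.
  have -> : y = x - r%:Z + (- q) * n%:Z by rewrite mulNr; lia.
  rewrite periodic_mulr // mulNr.
  have : r \in iota 0 n by rewrite mem_iota.
  by move=> /lb -/(_ x); lia.
have [y0 hy0] := att (iota 0 n) 0; set c := m _ 0 in hy0.
have lbc x : x + c <= f x by have := glb 0 x; rewrite -/c; lia.
exists c; split=> //; last by exists y0; lia.
apply: FZ_eq => x; change (m (iota 0 n) x = x + c).
have := glb x y0; have [y] := att (iota 0 n) x.
by have := lbc y; lia.
Qed.

(** At [x], the product of [f `&` g] with the left adjoint of [f `|` g] is the
    value of [f `&` g] at the first point [p] where [f `|` g] reaches [x]; compared
    with [x] this loses at most [|f p - g p|], and exactly that if [x] is the value
    of [f `|` g] at [p]. *)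
Lemma gapP n f g : (0 < n)%N -> periodic n f -> periodic n g ->
  exists c, [/\ gap n (f : F_Z) g = translation (- c),
    forall x, `|f x - g x| <= c & exists x, `|f x - g x| = c].
Proof.
move=> n0 pf pg.
have pfg : periodic n (FZ_mul (FZ_meet f g) (FZ_left (FZ_join f g))).
  apply: (sub_mul (periodic_subuniverse n)).
    exact: (sub_meet (periodic_subuniverse n)).
  apply: (sub_left (periodic_subuniverse n)).
  exact: (sub_join (periodic_subuniverse n)).
have [c [eq lb [x0 hx0]]] := orbit_meetP n0 pfg.
have ub x : `|f x - g x| <= - c.
  have /= := lb (Num.max (f x) (g x)).
  have := left_funP (FZ_join f g) (Num.max (f x) (g x)) x => /=.
  rewrite lexx; set p := left_fun _ _ => px.
  by have := FZ_homo f px; have := FZ_homo g px; lia.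
exists (- c); split=> //; first by rewrite opprK.
have := left_funP (FZ_join f g) x0 (left_fun (FZ_join f g) x0).
move: hx0; rewrite lexx /=; set p := left_fun _ x0 => hp /esym hx0.
by exists p; have := ub p; lia.
Qed.

(** * Subuniverses of periodic maps *)

Lemma sub_FZ_meet (P : set F_Z) : subuniverse P ->
  forall f g : FZ, P f -> P g -> P (FZ_meet f g).
Proof. by move=> hP; exact: (sub_meet hP). Qed.

Lemma sub_FZ_join (P : set F_Z) : subuniverse P ->
  forall f g : FZ, P f -> P g -> P (FZ_join f g).
Proof. by move=> hP; exact: (sub_join hP). Qed.

Lemma sub_FZ_mul (P : set F_Z) : subuniverse P ->
  forall f g : FZ, P f -> P g -> P (FZ_mul f g).
Proof. by move=> hP; exact: (sub_mul hP). Qed.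

Lemma conjugateD i j f : conjugate i (conjugate j f) = conjugate (i + j) f.
Proof.
apply: FZ_eq => x /=; have -> : x - (i + j) = x - i - j by rewrite opprD addrA.
by rewrite -addrA [j + i]addrC.
Qed.

Lemma sub_conjugate (P : set F_Z) i f : subuniverse P -> P f -> P (conjugate i f).
Proof.
move=> hP Pf; have pos (j : nat) : P (conjugate j%:Z f).
  rewrite -iter_left2; elim: (j.*2) => //= m; exact: (sub_left hP).
case: i => i; first exact: pos.
rewrite NegzE; elim: (i.+1) => [|j IH]; first by rewrite oppr0; exact: (pos 0%N).
have -> : - j.+1%:Z = -1 - j%:Z by lia.
by rewrite -conjugateD -FZ_right2; do 2 apply: (sub_right hP).
Qed.

Lemma sub_orbit_meet (A : algebra) (P : set A) n (x : A) :
  subuniverse P -> P x -> P (orbit_meet n x).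
Proof.
move=> hP Px; rewrite /orbit_meet; elim: (iota 0 n) => //= i l IH.
by apply: sub_meet => //; elim: (i.*2) => //= m; apply: sub_left.
Qed.

Lemma sub_translation_opp (P : set F_Z) c : subuniverse P ->
  P (translation c) -> P (translation (- c)).
Proof. by move=> hP Pc; rewrite -FZ_left_translation; exact: (sub_left hP). Qed.

(** Finite meets are attained pointwise, because the integers are linearly
    ordered. *)
Lemma finite_meet (P : set F_Z) (u : nat -> FZ) n : subuniverse P ->
  (forall a, (a <= n)%N -> P (u a)) ->
  exists g : FZ, [/\ P g, forall x a, (a <= n)%N -> g x <= u a x
    & forall x, exists2 a, (a <= n)%N & g x = u a x].
Proof.
move=> hP; elim: n => [|n IH] hu.
  exists (u 0%N); split; [exact: hu|by move=> x [|a]|by move=> x; exists 0%N].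
have [|g [Pg gle gat]] := IH; first by move=> a an; apply: hu; apply: leqW.
exists (FZ_meet g (u n.+1)); split.
- by apply: sub_FZ_meet => //; apply: hu.
- move=> x a; rewrite leq_eqVlt => /orP[/eqP ->|an] /=.
    by rewrite ge_min lexx orbT.
  by rewrite ge_min gle.
move=> x /=; have [a an ga] := gat x.
have [le|le] := leP (g x) (u n.+1 x); first by exists a => //; apply: leqW.
by exists n.+1.
Qed.

Lemma residue_induction (k : nat) (Q : int -> Prop) (a b : int) :
  (forall x, Q x -> Q (x + k%:Z)) -> (forall x, Q x -> Q (x - k%:Z)) ->
  (exists q : int, b = a + q * k%:Z) -> Q a -> Q b.
Proof.
move=> up dn [q ->] Qa; case: q => j; rewrite ?NegzE.
  elim: j => [|j IH]; first by rewrite mul0r addr0.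
  by rewrite -addn1 PoszD mulrDl mul1r addrA; apply: up.
move: (j.+1) => {}j; elim: j => [|j IH]; first by rewrite oppr0 mul0r addr0.
by rewrite -addn1 PoszD opprD mulrDl mulN1r addrA; apply: dn.
Qed.

Lemma residue_unique (k r j : nat) (q : int) : (r < k)%N -> (j < k)%N ->
  r%:Z - j%:Z = q * k%:Z -> r = j.
Proof.
move=> rk jk e.
have [q0|[q1|q1]] : q = 0 \/ 1 <= q \/ q <= -1 by lia.
- by move: e; rewrite q0 mul0r; lia.
- by have : 1 * k%:Z <= q * k%:Z by [apply: ler_wpM2r]; lia.
- by have : q * k%:Z <= -1 * k%:Z by [apply: ler_wpM2r]; lia.
Qed.

Section Subuniverses.
Variables (P : set F_Z) (n : nat).
Hypotheses (hP : subuniverse P) (n0 : (0 < n)%N).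
Hypothesis per : forall f : FZ, P f -> periodic n f.

(** The subuniverse is recovered from a map [h >= id] in it, with both fixed and
    moved points, that moves as few residues modulo [n] as possible. *)
Definition moved (f : FZ) (x : int) := f x != x.

Lemma moved_mod (f : FZ) q x : P f -> moved f (x + q * n%:Z) = moved f x.
Proof.
by move=> /per pf; rewrite /moved periodic_mulr // (inj_eq (addIr _)).
Qed.

Definition expanding (f : FZ) := P f /\ forall x, x <= f x.
Definition proper_expanding (f : FZ) :=
  [/\ expanding f, exists x, f x = x & exists x, moved f x].

Lemma expanding_conjugate i f : expanding f -> expanding (conjugate i f).
Proof.
move=> [Pf lef]; split; first exact: sub_conjugate.
by move=> x /=; have := lef (x - i); lia.
Qed.

Lemma moved_conjugate i f x : moved (conjugate i f) x = moved f (x - i).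
Proof.
rewrite /moved /=; congr (~~ _); rewrite -[X in _ == X](subrK i x).
exact: (inj_eq (addIr i)).
Qed.

(** Dividing [f] by the translation [orbit_meet n f] makes its least displacement
    equal to 0. *)
Lemma proper_expanding_exists :
  (exists2 f : FZ, P f & ~ periodic 1 f) -> exists h, proper_expanding h.
Proof.
move=> [f Pf nf].
have [c [eqc lec [x0 hx0]]] := orbit_meetP n0 (per Pf).
have Pc : P (translation (- c)).
  by apply: sub_translation_opp => //; rewrite -eqc; apply: sub_orbit_meet.
exists (FZ_mul (translation (- c)) f); split.
- split; first exact: sub_FZ_mul.
  by move=> x /=; have := lec x; lia.
- by exists x0 => /=; lia.
apply: contrapT => hne; apply: nf; apply/periodic1P; exists c.
apply: FZ_eq => x /=; apply: contrapT => hx; apply: hne; exists x.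
by rewrite /moved /=; apply/eqP; lia.
Qed.

Definition moved_count (f : FZ) : nat := #|[pred i : 'I_n | moved f i%:Z]|.

Definition minimal_expanding (h : FZ) :=
  proper_expanding h /\
  forall g, proper_expanding g -> (moved_count h <= moved_count g)%N.

Lemma minimal_exists :
  (exists2 f : FZ, P f & ~ periodic 1 f) -> exists h, minimal_expanding h.
Proof.
move=> /proper_expanding_exists[h0 ph0].
have ex : exists m, `[< exists2 h, proper_expanding h & moved_count h = m >].
  by exists (moved_count h0); apply/asboolP; exists h0.
have [m /asboolP[h ph <-] mh] := ex_minnP ex.
exists h; split=> // g pg; apply: mh; apply/asboolP; by exists g.
Qed.

Section MinimalMap.
Variables (h : FZ) (mh : minimal_expanding h).

(** The meet of [h] and [g] moves exactly the points moved by both, and it inherits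
    a fixed point of [h]; if it moves anything at all, minimality of [h] forces
    it to move everything that [h] moves. *)
Lemma minimal_sub g x : expanding g -> moved h x -> moved g x ->
  forall y, moved h y -> moved g y.
Proof.
move=> [Pg leg] hx gx; have [[[Ph leh] [z hz] _] hle] := mh.
have mhg y : moved (FZ_meet h g) y = moved h y && moved g y.
  rewrite /moved /=; have := leh y; have := leg y.
  have -> : (h y != y) = (y < h y) || (h y < y) by rewrite neq_lt orbC.
  have -> : (g y != y) = (y < g y) || (g y < y) by rewrite neq_lt orbC.
  have -> (u : int) : (u != y) = (y < u) || (u < y) by rewrite neq_lt orbC.
  by move=> *; lia.
have phg : proper_expanding (FZ_meet h g).
  split; last by exists x; rewrite mhg hx.
    split; first exact: sub_FZ_meet.
    by move=> y /=; have := leh y; have := leg y; lia.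
  by exists z => /=; have := leg z; lia.
have sub : [pred i : 'I_n | moved (FZ_meet h g) i%:Z]
           \subset [pred i : 'I_n | moved h i%:Z].
  by apply/fintype.subsetP => i; rewrite !inE mhg => /andP[].
have eqc : moved_count (FZ_meet h g) = moved_count h.
  by apply/eqP; rewrite eqn_leq (subset_leq_card sub) hle.
move=> y hy; have sub2 := elimT (subset_cardP eqc) sub.
have [r [q [rn ey]]] := int_residue 0 y n0.
move: hy; rewrite ey !moved_mod // add0r => hr.
by have := sub2 (Ordinal rn); rewrite !inE /= mhg hr.
Qed.

(** If [h] moved both [x] and [x + 1], then it would be comparable, in the sense of
    [minimal_sub], with its conjugate by 1, and the set of moved points would be
    closed under predecessor, leaving no fixed point.  So [x + 1] is fixed, and
    monotonicity squeezes [h x] between [x] and [x + 1]. *)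
Lemma minimal_step x : moved h x -> h x = x + 1.
Proof.
move=> hx; have [[Ih [z hz] _] _] := mh; have [Ph leh] := Ih.
suff nx : ~~ moved h (x + 1).
  have := FZ_homo h (_ : x <= x + 1); move: nx hx; rewrite /moved => /negPn/eqP ->.
  by have := leh x; move=> ? /eqP ? /(_ ltac:(lia)); lia.
apply/negP => hx1.
have prev y : moved h y -> moved h (y - 1).
  rewrite -moved_conjugate; apply: (@minimal_sub _ (x + 1)) => //.
    exact: expanding_conjugate.
  by rewrite moved_conjugate addrK.
have down (i : nat) y : moved h y -> moved h (y - i%:Z).
  elim: i => [|i IH] /=; first by rewrite subr0.
  by move=> /IH/prev; have -> : y - i%:Z - 1 = y - i.+1%:Z by lia.
have [r [q [rn ez]]] := int_residue x z n0.
have : moved h z.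
  rewrite ez moved_mod //; have -> : x + r%:Z = x + 1 * n%:Z - (n - r)%N%:Z by lia.
  by apply: down; rewrite moved_mod.
by rewrite /moved hz eqxx.
Qed.

(** The conjugate of [h] by [x - y] moves [x], hence all points moved by [h]. *)
Lemma minimal_diff x y z :
  moved h x -> moved h y -> moved h z -> moved h (z + (y - x)).
Proof.
move=> hx hy hz; have [[Ih _ _] _] := mh.
have -> : z + (y - x) = z - (x - y) by lia.
rewrite -moved_conjugate; apply: (@minimal_sub _ x) hz => //.
  exact: expanding_conjugate.
by rewrite moved_conjugate; have -> : x - (x - y) = y by lia.
Qed.

(** By [minimal_diff] the differences of moved points form a subgroup of the
    integers; [k] is its positive generator. *)
Lemma minimal_class : exists (k : nat) (x0 : int), [/\ (0 < k)%N, (k %| n)%N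
  & forall y, moved h y <-> exists q : int, y = x0 + q * k%:Z].
Proof.
have [[[Ph leh] _ [x0 hx0]] _] := mh.
have ex : exists i, (0 < i)%N && moved h (x0 + i%:Z).
  by exists n; rewrite n0 -[n%:Z]mul1r moved_mod.
have [k /andP[k0 hk] kmin] := ex_minnP ex.
have up y : moved h y -> moved h (y + k%:Z).
  move=> hy; have := minimal_diff hx0 hk hy.
  by have -> : y + (x0 + k%:Z - x0) = y + k%:Z by lia.
have dn y : moved h y -> moved h (y - k%:Z).
  move=> hy; have := minimal_diff hk hx0 hy.
  by have -> : y + (x0 - (x0 + k%:Z)) = y - k%:Z by lia.
have cls y : moved h y <-> exists q : int, y = x0 + q * k%:Z.
  split=> [hy|[q ey]]; last first.
    by apply: (residue_induction up dn) hx0; exists q.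
  have [r [q [rk ey]]] := int_residue x0 y k0.
  have hr : moved h (x0 + r%:Z).
    by apply: (residue_induction up dn) hy; exists (- q); rewrite ey mulNr addrK.
  exists q; rewrite ey; case: r rk hr {ey} => [|r] rk hr; first by rewrite addr0.
  by have := kmin r.+1; rewrite hr /= leqNgt rk => /(_ isT).
exists k, x0; split=> //.
have : moved h (x0 + 1 * n%:Z) by rewrite moved_mod.
move=> /cls[q eq]; have {}eq : n%:Z = q * k%:Z by lia.
by have := congr1 absz eq; rewrite abszM /= => ->; apply: dvdn_mull.
Qed.

End MinimalMap.

(** The conjugates of the minimal map [h] are the maps adding 1 on one residue class
    modulo [k]; their joins add 1 on any union of classes, and include the
    translation by 1.  Every [f] in the subuniverse is [k]-periodic, since the points
    where its displacement exceeds a given constant are those moved by a map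
    comparable with all conjugates of [h].  Conversely a [k]-periodic [f] is the
    meet, over the residues [a], of the largest [k]-periodic maps that agree with
    [f] at [a]. *)
Lemma subuniverse_periodic : (exists2 f : FZ, P f & ~ periodic 1 f) ->
  exists k : nat, [/\ (0 < k)%N, (k %| n)%N & forall f : FZ, P f <-> periodic k f].
Proof.
move=> /minimal_exists[h mh].
have [k [x0 [k0 kn cls]]] := minimal_class mh.
have [[[Ph leh] _ _] _] := mh.
exists k; split=> // f.
have hx0 : moved h x0 by apply/cls; exists 0; rewrite mul0r addr0.
(* Joins of conjugates of [h]: add 1 on the classes of [a], ..., [a + j - 1]. *)
have steps (a : int) (j : nat) : (j <= k)%N -> exists2 g : FZ, P g &
    forall (r : nat) (q : int), (r < k)%N ->
      g (a + r%:Z + q * k%:Z) = a + r%:Z + q * k%:Z + (r < j)%N%:Z.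
  elim: j => [|j IH] jk.
    by exists FZ_one; [exact: (sub_one hP)|move=> r q _ /=; lia].
  have [g Pg gE] := IH (ltnW jk).
  exists (FZ_join g (conjugate (a + j%:Z - x0) h)).
    by apply: sub_FZ_join => //; apply: sub_conjugate.
  move=> r q rk /=; rewrite gE //.
  set x := a + _ + _; set y := x - _.
  have [hy|hy] := boolP (moved h y).
    rewrite (minimal_step mh hy).
    have /cls[q' eq'] := hy.
    have : r = j.
      by apply: (@residue_unique k _ _ (q' - q)) => //; rewrite /y /x in eq'; lia.
    by move=> ->; rewrite /y; lia.
  move: (hy); rewrite /moved negbK => /eqP ->.
  have : r <> j.
    move=> rj; move/negP: hy; apply; apply/cls; exists q.
    by rewrite /y /x rj; lia.
  by rewrite /y; lia.
have Pt1 : P (translation 1).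
  have [g Pg gE] := steps 0 k (leqnn k).
  have -> : translation 1 = g; last by [].
  apply: FZ_eq => x /=; have [r [q [rk ->]]] := int_residue 0 x k0.
  by rewrite gE // rk.
have Pt c : P (translation c).
  have pos (i : nat) : P (translation i%:Z).
    elim: i => [|i IH].
      have -> : translation 0 = FZ_one by apply: FZ_eq => x /=; rewrite addr0.
      exact: (sub_one hP).
    have -> : translation i.+1%:Z = FZ_mul (translation 1) (translation i%:Z).
      by apply: FZ_eq => x /=; lia.
    exact: sub_FZ_mul.
  case: c => i; first exact: pos.
  rewrite NegzE; apply: sub_translation_opp => //; exact: pos.
split=> [Pf x|pf].
  have disp_le (u v : int) :
      (exists q : int, v = u + q * k%:Z) -> f u + (v - u) <= f v.
    move=> [q ev]; pose c := f u - u - 1.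
    pose g := FZ_join (FZ_mul (translation (- c)) f) FZ_one.
    have Ig : expanding g.
      split; last by move=> y /=; lia.
      by apply: sub_FZ_join => //; [exact: sub_FZ_mul|exact: (sub_one hP)].
    have gu : moved (conjugate (x0 - u) g) x0.
      rewrite moved_conjugate subKr /moved /= /c; lia.
    have := minimal_sub mh (expanding_conjugate _ Ig) hx0 gu (y := x0 + q * k%:Z).
    have -> : moved h (x0 + q * k%:Z) by apply/cls; exists q.
    move=> /(_ isT); rewrite moved_conjugate.
    have -> : x0 + q * k%:Z - (x0 - u) = v by lia.
    by rewrite /moved /= /c; lia.
  have := disp_le x (x + k%:Z); have := disp_le (x + k%:Z) x.
  have h1 : exists q : int, x + k%:Z = x + q * k%:Z by exists 1; lia.
  have h2 : exists q : int, x = x + k%:Z + q * k%:Z by exists (-1); lia.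
  by move=> /(_ h2) + /(_ h1); lia.
(* The closure operator onto the class of [a]: iterate the map that adds 1 off
   that class. *)
have closure a : exists2 g : FZ, P g & forall (i : nat) (q : int), (i < k)%N ->
    g (a - i%:Z + q * k%:Z) = a + q * k%:Z.
  have [s Ps sE] := steps (a - k.-1%:Z) k.-1 (leq_pred k).
  have sE' (i : nat) q : (i < k)%N ->
      s (a - i%:Z + q * k%:Z) = a - i.-1%:Z + q * k%:Z.
    move=> ik; have := sE (k.-1 - i)%N q.
    have -> : a - k.-1%:Z + (k.-1 - i)%N%:Z = a - i%:Z by lia.
    by move=> ->; lia.
  have it (j : nat) : exists2 g : FZ, P g & forall (i : nat) (q : int), (i < k)%N ->
      g (a - i%:Z + q * k%:Z) = a - (i - j)%N%:Z + q * k%:Z.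
    elim: j => [|j [g Pg gE]].
      by exists FZ_one; [exact: (sub_one hP)|move=> i q _ /=; rewrite subn0].
    exists (FZ_mul s g); first exact: sub_FZ_mul.
    move=> i q ik /=; rewrite gE // sE'; last by lia.
    by have -> : (i - j).-1 = (i - j.+1)%N by lia.
  have [g Pg gE] := it k; exists g => // i q ik; rewrite gE //.
  have -> : (i - k)%N = 0%N by lia.
  by rewrite subr0.
(* The greatest [k]-periodic map agreeing with [f] at [a]: round up to the class
   of [a], then translate. *)
have touching (a : nat) : exists g : FZ, P g /\
    forall (i : nat) (q : int), (i < k)%N ->
      g (a%:Z - i%:Z + q * k%:Z) = f (a%:Z + q * k%:Z).
  have [g Pg gE] := closure a%:Z.
  exists (FZ_mul (translation (f a%:Z - a%:Z)) g); split.
    exact: sub_FZ_mul.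
  by move=> i q ik /=; rewrite gE // periodic_mulr //; lia.
have [u hu] := boolp.choice touching.
have [|g [Pg gle gat]] := @finite_meet P u k.-1 hP.
  by move=> a _; have [] := hu a.
have -> : f = g; last by [].
have ub x a : f x <= u a x.
  have [i [q [ik ex]]] := int_residue (- a%:Z) (- x) k0.
  have -> : x = a%:Z - i%:Z + (- q) * k%:Z by rewrite mulNr; lia.
  have [_ ->] := hu a; last by [].
  by apply: FZ_homo; lia.
apply: FZ_eq => x; apply/eqP; rewrite eq_le; apply/andP; split.
  by have [a _ ->] := gat x.
have [r [q [rk ex]]] := int_residue 0 x k0.
have := gle x r; have [_ /(_ 0%N q k0)] := hu r.
have -> : r%:Z - 0%:Z + q * k%:Z = x by lia.
have -> : r%:Z + q * k%:Z = x by lia.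
by move=> -> -> //; lia.
Qed.

End Subuniverses.

(** * Evaluation of terms near translations *)

(** Perturbations are measured in multiples of the period because then a periodic
    map carries a perturbation of its argument to an equal one of its value. *)
Lemma eval_Lipschitz n t : exists M : nat, forall v w : nat -> FZ,
  (forall i, periodic n (v i)) -> (forall i, periodic n (w i)) ->
  (forall i x, `|v i x - w i x| <= n%:Z) ->
  forall x, `|evalZ v t x - evalZ w t x| <= M%:Z * n%:Z.
Proof.
elim: t => [i|s [M hM] t [M' hM']|s [M hM] t [M' hM']|s [M hM] t [M' hM']||
            t [M hM]|t [M hM]].
- by exists 1%N => v w hv hw h x; rewrite mul1r; apply: h.
- exists (M + M')%N => v w hv hw h x; have := hM v w hv hw h x.
  by have := hM' v w hv hw h x; rewrite /= PoszD mulrDl; lia.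
- exists (M + M')%N => v w hv hw h x; have := hM v w hv hw h x.
  by have := hM' v w hv hw h x; rewrite /= PoszD mulrDl; lia.
- exists (M + M')%N => v w hv hw h x.
  pose f := evalZ v s; pose g := evalZ w s.
  pose y := evalZ v t x; pose z := evalZ w t x.
  change (`|f y - g z| <= (M + M')%N%:Z * n%:Z).
  have := hM v w hv hw h z; rewrite -/f -/g.
  have := hM' v w hv hw h x; rewrite -/y -/z => yz.
  have pf : periodic n f by apply: periodic_eval.
  have yz1 : y <= z + M'%:Z * n%:Z by lia.
  have yz2 : z - M'%:Z * n%:Z <= y by lia.
  have := FZ_homo f yz1; have := FZ_homo f yz2.
  by rewrite -mulNr !periodic_mulr // PoszD mulrDl mulNr; lia.
- by exists 0%N => v w *; rewrite /= subrr normr0 mul0r.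
- exists M => v w hv hw h x.
  have pf := periodic_eval t hv; have pg := periodic_eval t hw.
  move: (hM v w hv hw h) pf pg => /=; set f := evalZ v t; set g := evalZ w t.
  move: f g => f g fg pf pg.
  have up : left_fun f x <= left_fun g x + M%:Z * n%:Z.
    rewrite left_funP periodic_mulr //.
    have := left_funP g x (left_fun g x); rewrite lexx => /esym.
    by have := fg (left_fun g x); lia.
  have dn : left_fun g x <= left_fun f x + M%:Z * n%:Z.
    rewrite left_funP periodic_mulr //.
    have := left_funP f x (left_fun f x); rewrite lexx => /esym.
    by have := fg (left_fun f x); lia.
  by lia.
- exists M => v w hv hw h x.
  have pf := periodic_eval t hv; have pg := periodic_eval t hw.
  move: (hM v w hv hw h) pf pg => /=; set f := evalZ v t; set g := evalZ w t.
  move: f g => f g fg pf pg.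
  have up : right_fun f x - M%:Z * n%:Z <= right_fun g x.
    rewrite right_funP -mulNr periodic_mulr //.
    have := right_funP f x (right_fun f x); rewrite lexx => /esym.
    by have := fg (right_fun f x); lia.
  have dn : right_fun g x - M%:Z * n%:Z <= right_fun f x.
    rewrite right_funP -mulNr periodic_mulr //.
    have := right_funP g x (right_fun g x); rewrite lexx => /esym.
    by have := fg (right_fun g x); lia.
  by lia.
Qed.

(** On translations, terms are built from minimum, maximum, sum and negation of
    integers, and nonnegative scaling commutes with all of these. *)
Lemma eval_translation_homogeneous t (z : nat -> int) : exists a : int,
  forall d : int, 0 <= d ->
    evalZ (fun i => translation (d * z i)) t = translation (d * a).
Proof.
elim: t => [i|s [a sa] t [b tb]|s [a sa] t [b tb]|s [a sa] t [b tb]||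
            t [b tb]|t [b tb]].
- by exists (z i).
- exists (Num.min a b) => d d0; apply: FZ_eq => x /=.
  by rewrite sa // tb //= minr_pMr // addr_minr.
- exists (Num.max a b) => d d0; apply: FZ_eq => x /=.
  by rewrite sa // tb //= maxr_pMr // addr_maxr.
- exists (b + a) => d d0; apply: FZ_eq => x /=.
  by rewrite sa // tb //= mulrDr addrA.
- by exists 0 => d _; apply: FZ_eq => x /=; rewrite mulr0 addr0.
- exists (- b) => d d0 /=; rewrite tb // mulrN.
  exact: FZ_left_translation.
- exists (- b) => d d0 /=; rewrite tb // mulrN.
  exact: FZ_right_translation.
Qed.

(** * Transferring bounds on distances to an algebra *)

Lemma gap_eq0 n f g : (0 < n)%N -> periodic n f -> periodic n g -> f = g ->
  gap n (f : F_Z) g = FZ_one.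
Proof.
move=> n0 pf pg <-; have [c [-> _ [x hx]]] := gapP n0 pf pf.
by apply: FZ_eq => y /=; move: hx; rewrite subrr normr0 => <-; rewrite oppr0 addr0.
Qed.

Section Transfer.
Variables (n : nat) (A : algebra) (n0 : (0 < n)%N) (dlpA : DLP A).
Hypothesis hA : forall e, F_satisfies n e -> satisfies A e.

Lemma gapxx (x : A) : gap n x x = aone.
Proof.
have /(_ (fun=> x)) : satisfies A (gap n (Var 0 : term_algebra) (Var 0), One).
  apply: hA => v hv /=; rewrite eval_gap. exact: (gap_eq0 n0 (hv 0%N) (hv 0%N)).
by rewrite /= eval_gap.
Qed.

Lemma join_le_meet (a b : A) : ale (ajoin a b) (ameet a b) -> a = b.
Proof.
case: dlpA => [[[mC mA mj] [jC _ jm] _ _ _] _]; rewrite /ale.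
rewrite mA [ameet _ a]mC mj => ab.
have mid (c : A) : ameet c c = c by rewrite -{2}(jm c c) mj.
have ea : a = ameet a b by rewrite -{1}(mj a b) -ab mA mid.
have eb : b = ameet a b by rewrite -{1}(mj b a) jC -ab mC -mA mid.
by rewrite ea -eb.
Qed.

Definition gap_product (I : finType) (L : I -> term * term) : term :=
  foldr (fun i => Mul (gap n ((L i).1 : term_algebra) (L i).2)) One (enum I).

Lemma eval_gap_product (I : finType) (L : I -> term * term) (v : nat -> FZ) :
  (forall i, periodic n (v i)) -> exists q : int,
    [/\ 0 <= q, evalZ v (gap_product L) = translation (- q)
      & forall i x, `|evalZ v (L i).1 x - evalZ v (L i).2 x| <= q].
Proof.
move=> hv; rewrite /gap_product.
suff [q [q0 qE qle]] : exists q : int, [/\ 0 <= q,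
    evalZ v (foldr (fun i => Mul (gap n ((L i).1 : term_algebra) (L i).2)) One
      (enum I)) = translation (- q)
    & forall i x, i \in enum I -> `|evalZ v (L i).1 x - evalZ v (L i).2 x| <= q].
  by exists q; split=> // i x; apply: qle; rewrite mem_enum.
elim: (enum I) => [|i s [q [q0 qE qle]]] /=.
  by exists 0; split=> //; apply: FZ_eq => x /=; rewrite oppr0 addr0.
have [c [cE cle [y hy]]] :=
  gapP n0 (periodic_eval (L i).1 hv) (periodic_eval (L i).2 hv).
exists (c + q); split; first by lia.
  by rewrite eval_gap cE qE; apply: FZ_eq => x /=; lia.
move=> j x; rewrite inE => /orP[/eqP ->|/qle-/(_ x)]; last by lia.
by have := cle x; lia.
Qed.

(** With [t] the [M]-th power of the product of the gaps of the [L i], the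
    hypothesis makes the inequality of [t * (e.1 `|` e.2)] with [e.1 `&` e.2] valid in
    [F_n], hence in [A], where [t] evaluates to the identity. *)
Lemma satisfies_of_gap_bound (I : finType) (L : I -> term * term) (M : nat) e :
  (forall i, satisfies A (L i)) ->
  (forall v : nat -> FZ, (forall i, periodic n (v i)) ->
    forall x, evalZ v e.1 x <> evalZ v e.2 x -> exists i y,
      `|evalZ v e.1 x - evalZ v e.2 x| <=
      M%:Z * `|evalZ v (L i).1 y - evalZ v (L i).2 y|) ->
  satisfies A e.
Proof.
move=> hL dom w; apply: join_le_meet.
pose t := iter M (Mul (gap_product L)) One.
have [[_ _ [_ lid _] _ _] _] := dlpA.
have tE : eval w t = aone.
  have -> : eval w t = iter M (amul (eval w (gap_product L))) aone.
    by rewrite /t; elim: M {dom t} => //= m ->.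
  have -> : eval w (gap_product L) = aone.
    rewrite /gap_product; elim: (enum I) => //= i s ->.
    by rewrite eval_gap (hL i w) gapxx lid.
  by elim: M {dom t} => //= m ->; rewrite lid.
pose l := Mul t (Join e.1 e.2).
have : satisfies A (Meet l (Meet e.1 e.2), l).
  apply: hA => v hv; apply: FZ_eq => x /=.
  have [q [q0 qE qle]] := eval_gap_product L hv.
  have {}tE : evalZ v t = translation (- (M%:Z * q)).
    rewrite /t; elim: M {dom t tE l} => [|m IH] /=.
      by apply: FZ_eq => y /=; rewrite mul0r oppr0 addr0.
    rewrite qE [X in FZ_mul _ X]IH; apply: FZ_eq => y /=.
    by rewrite -addn1 PoszD mulrDl mul1r; lia.
  rewrite tE /=; apply: min_idPl.
  have Mq : 0 <= M%:Z * q by rewrite mulr_ge0.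
  have [eq|/eqP ne] := eqVneq (evalZ v e.1 x) (evalZ v e.2 x); first by lia.
  have [i [y]] := dom v hv x ne.
  have := ler_wpM2l (_ : 0 <= M%:Z) (qle i y) => /(_ isT).
  by lia.
by move=> /(_ w); rewrite /= tE lid.
Qed.

End Transfer.

(** * Failing equations *)

(** The power of the inverse of [g] with integer exponent [z]. *)
Lemma translation_term (g : term) (z : int) : exists w : term,
  forall (v : nat -> FZ) d, evalZ v g = translation (- d) ->
    evalZ v w = translation (d * z).
Proof.
case: z => [m|m].
  exists (iter m (Mul (Left g)) One) => v d gE; elim: m => [|m IH] /=.
    by apply: FZ_eq => x /=; rewrite mulr0 addr0.
  rewrite gE [X in FZ_mul _ X]IH FZ_left_translation; apply: FZ_eq => x /=.
  by rewrite -addn1 PoszD mulrDr mulr1; lia.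
exists (iter m.+1 (Mul g) One) => v d gE; rewrite NegzE.
elim: (m.+1) => [|{}m IH] /=.
  by apply: FZ_eq => x /=; rewrite mulrN mulr0 addr0.
rewrite gE [X in FZ_mul _ X]IH; apply: FZ_eq => x /=.
by rewrite -addn1 PoszD !mulrN mulrDr mulr1; lia.
Qed.

Section Failures.
Variables (n : nat) (A : algebra) (n0 : (0 < n)%N) (dlpA : DLP A).
Hypothesis hA : forall e, F_satisfies n e -> satisfies A e.

Lemma satisfies_subst w e :
  satisfies A e -> satisfies A (subst w e.1, subst w e.2).
Proof. by move=> h v /=; rewrite !eval_subst; apply: h. Qed.

(** Let [e1] fail in [F_1] at the translations by [z i].  Substituting for the
    variables the [z i]-th powers of the inverse of the gap of [e] scales that failure
    by the distance of [e], so one equation of [A] already bounds that distance. *)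
Lemma satisfies_of_not_F_1 e1 e :
  satisfies A e1 -> ~ F_satisfies 1 e1 -> satisfies A e.
Proof.
move=> Ae1 /existsNP[u /not_implyP[pu ne1]].
have [z zE] := boolp.choice (fun i => proj1 (periodic1P (u i)) (pu i)).
have [w wE] := boolp.choice
  (fun i => translation_term (gap n (e.1 : term_algebra) e.2) (z i)).
apply: (@satisfies_of_gap_bound n A n0 dlpA hA unit
  (fun=> (subst w e1.1, subst w e1.2)) 1 e) => [_|v hv x _].
  exact: satisfies_subst.
have [d [dE dle [y hy]]] := gapP n0 (periodic_eval e.1 hv) (periodic_eval e.2 hv).
have d0 : 0 <= d by rewrite -hy.
have [a aE] := eval_translation_homogeneous e1.1 z.
have [b bE] := eval_translation_homogeneous e1.2 z.
exists tt, x; rewrite mul1r /= !eval_subst.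
have -> : (fun i => evalZ v (w i)) = fun i => translation (d * z i).
  by apply/funext => i; apply: wE; rewrite eval_gap.
rewrite aE // bE //=.
have ab : a != b.
  apply/eqP => ab; apply: ne1.
  have -> : u = fun i => translation (1 * z i).
    by apply/funext => i; rewrite mul1r.
  by rewrite aE // bE // ab.
have -> : x + d * a - (x + d * b) = d * (a - b) by rewrite mulrBr; lia.
rewrite normrM (ger0_norm d0); apply: (le_trans (dle x)).
by rewrite ler_peMr //; lia.
Qed.

Section Normalise.
Variable (p : nat).

(** Dividing the value of a variable by its [orbit_meet] leaves displacements between
    0 and [n], hence finitely many possibilities.  Only the first [p] variables are
    kept, so that there are finitely many normalised assignments. *)
Definition normalise (i : nat) : term :=
  if (i < p)%N then Mul (Left (orbit_meet n (Var i : term_algebra))) (Var i)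
  else One.

(** The upper bound comes from a point of least displacement in the period just
    to the right. *)
Lemma normaliseP v i : periodic n (v i) -> let u := evalZ v (normalise i) in
  [/\ periodic n u, forall x : int, x <= u x <= x + n%:Z
    & (i < p)%N -> exists c, v i = FZ_mul (translation c) u].
Proof.
move=> hv; rewrite /normalise; case: ifP => ip; last by split=> // x /=; lia.
have [c [cE cle [y hy]]] := orbit_meetP n0 hv.
have -> : evalZ v (Mul (Left (orbit_meet n (Var i : term_algebra))) (Var i)) =
          FZ_mul (translation (- c)) (v i).
  by rewrite /= eval_orbit_meet cE FZ_left_translation.
split=> [x|x|_] /=; first by rewrite hv; lia.
- apply/andP; split; first by have := cle x; lia.
  have [r [q [rn ex]]] := int_residue (y - n%:Z) x n0.
  have le : x <= y + q * n%:Z by lia.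
  by have := FZ_homo (v i) le; rewrite periodic_mulr // hy; lia.
- by exists c; apply: FZ_eq => x /=; lia.
Qed.

Definition code (v : nat -> FZ) : {ffun 'I_p -> {ffun 'I_n -> 'I_n.+1}} :=
  [ffun i : 'I_p => [ffun j : 'I_n =>
    inord (absz (evalZ v (normalise i) j%:Z - j%:Z))]].

Lemma code_inj v v' :
  (forall i, periodic n (v i)) -> (forall i, periodic n (v' i)) ->
  code v = code v' ->
  forall i, evalZ v (normalise i) = evalZ v' (normalise i).
Proof.
move=> hv hv' cvv i.
have [ip|ip] := boolP (i < p)%N; last by rewrite /normalise (negbTE ip).
have [pu ub _] := normaliseP (hv i); have [pu' ub' _] := normaliseP (hv' i).
apply: FZ_eq => x; have [r [q [rn ->]]] := int_residue 0 x n0.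
rewrite !periodic_mulr // add0r; congr (_ + _).
have := congr1
  (fun c : {ffun _ -> {ffun _ -> _}} => c (Ordinal ip) (Ordinal rn)) cvv.
rewrite !ffunE => /(congr1 (@nat_of_ord _)).
move: (ub r%:Z) (ub' r%:Z) => /=; set a := evalZ v _ _; set b := evalZ v' _ _.
by move=> /andP[ra ar] /andP[rb br]; rewrite !inordK; lia.
Qed.

(** The normalised values generate a subuniverse which does not consist of
    translations, as [F_1] satisfies [e]; so it is the set of all [k]-periodic maps,
    for some [k], and the original values are [k]-periodic too.  Thus [F_k] refutes
    [e], hence also an equation of [A], at elements that are values of terms. *)
Lemma failure_in_normal_form e (v : nat -> FZ) :
  (var_bound e.1 <= p)%N -> (var_bound e.2 <= p)%N -> F_satisfies 1 e ->
  (forall k : nat, (0 < k)%N -> (k %| n)%N ->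
    (forall e', satisfies A e' -> F_satisfies k e') -> F_satisfies k e) ->
  (forall i, periodic n (v i)) -> evalZ v e.1 <> evalZ v e.2 ->
  exists2 e', satisfies A e' &
    let u i := evalZ v (normalise i) in evalZ u e'.1 <> evalZ u e'.2.
Proof.
move=> p1 p2 F1 hF hv ne; pose u i := evalZ v (normalise i).
pose v0 i := if (i < p)%N then v i else FZ_one.
have restrict t : (var_bound t <= p)%N -> evalZ v t = evalZ v0 t.
  by move=> tp; apply: (@eval_ext F_Z) => i it; rewrite /v0 (leq_trans it tp).
have v0u k : (forall i, periodic k (u i)) -> forall i, periodic k (v0 i).
  move=> pu i; rewrite /v0; case: ifP => ip; last first.
    exact: (sub_one (periodic_subuniverse k)).
  have [_ _ /(_ ip)[c ->]] := normaliseP (hv i).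
  apply: (sub_mul (periodic_subuniverse k)) (pu i); exact: translation_periodic.
have ne0 k : F_satisfies k e -> ~ (forall i, periodic k (u i)).
  by move=> Fk /v0u pv0; apply: ne; rewrite !restrict //; apply: Fk.
have pu i : periodic n (u i) by have [] := normaliseP (hv i).
have hP := eval_subuniverse (A := F_Z) u.
have perP (f : FZ) : (exists t, evalZ u t = f) -> periodic n f.
  by move=> [t <-]; apply: periodic_eval.
have [|k [k0 kn Pk]] := subuniverse_periodic hP n0 perP.
  have /existsNP[i npi] := ne0 _ F1.
  by exists (u i) => //; exists (Var i).
have nFk : ~ F_satisfies k e.
  by move=> /ne0; apply=> i; apply/Pk; exists (Var i).
have : ~ forall e', satisfies A e' -> F_satisfies k e' by move=> /hF-/(_ k0 kn).
move=> /existsNP[e' /not_implyP[Ae' /existsNP[z /not_implyP[pz nez]]]].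
have [w wE] := boolp.choice (fun i => proj2 (Pk (z i)) (pz i)).
exists (subst w e'.1, subst w e'.2); first exact: satisfies_subst.
rewrite /= !eval_subst; have -> : (fun i => evalZ u (w i)) = z by apply/funext.
exact: nez.
Qed.

End Normalise.

(** A choice of one refuted equation of [A] for each code yields finitely many
    equations; one of them has distance at least 1 where [e] fails, while the distance
    of [e] is bounded by comparison with nearby translations. *)
Lemma satisfies_of_divisors e : F_satisfies 1 e ->
  (forall k : nat, (0 < k)%N -> (k %| n)%N ->
    (forall e', satisfies A e' -> F_satisfies k e') -> F_satisfies k e) ->
  satisfies A e.
Proof.
move=> F1 hF; pose p := maxn (var_bound e.1) (var_bound e.2).
pose nrm := normalise p.
have wit c : exists e', satisfies A e' /\ forall v : nat -> FZ,
    (forall i, periodic n (v i)) -> code p v = c ->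
    evalZ v e.1 <> evalZ v e.2 ->
    evalZ v (subst nrm e'.1) <> evalZ v (subst nrm e'.2).
  have [[v0 [hv0 cv0 ne0]]|none] := pselect (exists v0 : nat -> FZ,
      [/\ forall i, periodic n (v0 i), code p v0 = c
        & evalZ v0 e.1 <> evalZ v0 e.2]);
    last first.
    by exists (One, One); split=> // v hv cv ne; case: none; exists v.
  have [e' Ae' ne'] :=
    failure_in_normal_form (leq_maxl _ _) (leq_maxr _ _) F1 hF hv0 ne0.
  exists e'; split=> // v hv cv _; rewrite !eval_subst.
  have -> : (fun i => evalZ v (nrm i)) = fun i => evalZ v0 (nrm i);
    last exact: ne'.
  by apply/funext => i; apply: code_inj; rewrite // cv cv0.
have [L hL] := boolp.choice wit.
have [M1 lip1] := eval_Lipschitz n e.1; have [M2 lip2] := eval_Lipschitz n e.2.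
apply: (satisfies_of_gap_bound n0 dlpA hA
  (L := fun c => (subst nrm (L c).1, subst nrm (L c).2))
  (M := ((M1 + M2) * n)%N)).
  by move=> c; apply: satisfies_subst; have [] := hL c.
move=> v hv x nex; have [_ hc] := hL (code p v).
have ne : evalZ v e.1 <> evalZ v e.2 by move=> eq; apply: nex; rewrite eq.
have /existsNP[y ney] : ~ forall y, evalZ v (subst nrm (L (code p v)).1) y =
    evalZ v (subst nrm (L (code p v)).2) y.
  by move=> eq; apply: (hc v hv erefl ne); apply: FZ_eq.
exists (code p v), y => /=.
have near i : exists f : FZ, periodic 1 f /\ forall x, `|v i x - f x| <= n%:Z.
  have [_ ub /(_ (ltnSn i))[c vE]] := normaliseP i.+1 (hv i).
  exists (translation c); split; first exact: translation_periodic.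
  by move=> x'; rewrite vE /=; have := ub x'; lia.
have [w hw] := boolp.choice near.
have pw1 i : periodic 1 (w i) by have [] := hw i.
have pw i : periodic n (w i) by apply: periodic_dvd (pw1 i).
have vw i x' : `|v i x' - w i x'| <= n%:Z by have [_] := hw i.
have := lip1 v w hv pw vw x; have := lip2 v w hv pw vw x; rewrite (F1 w pw1).
set c := (M1 + M2)%N%:Z * n%:Z => h1 h2.
have {h1 h2}hc : `|evalZ v e.1 x - evalZ v e.2 x| <= c.
  by rewrite /c PoszD mulrDl; lia.
apply: (le_trans hc); rewrite PoszM -/c ler_peMr //; lia.
Qed.

Lemma failure_at_divisor e : ~ satisfies A e -> exists k : nat,
  [/\ (0 < k)%N, (k %| n)%N,
  forall e', satisfies A e' -> F_satisfies k e' & ~ F_satisfies k e].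
Proof.
move=> ne; apply: contrapT => none.
have hF k : (0 < k)%N -> (k %| n)%N ->
    (forall e', satisfies A e' -> F_satisfies k e') -> F_satisfies k e.
  by move=> k0 kn kA; apply: contrapT => nk; apply: none; exists k.
apply: ne; have [A1|] := pselect (forall e', satisfies A e' -> F_satisfies 1 e').
  by apply: satisfies_of_divisors => //; apply: hF.
by move=> /existsNP[e1 /not_implyP[Ae1 ne1]]; apply: satisfies_of_not_F_1 ne1.
Qed.

End Failures.

(** * Separating the F_n *)

Program Definition step (k : nat) : FZ :=
  @MkFZ (fun x : int => x + ((k%:Z %| x)%Z : nat)%:Z) _ _.
Next Obligation.
move=> k x y; rewrite le_eqVlt => /orP[/eqP ->|xy]; first exact: lexx.
by case: (k%:Z %| x)%Z; case: (k%:Z %| y)%Z; lia.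
Qed.
Next Obligation.
move=> k; apply: unbounded_finite; first exact: step_obligation_1.
  by move=> q; exists q; lia.
by move=> q; exists (q - 1); case: (_ %| _)%Z; lia.
Qed.

Lemma step_periodic k : periodic k (step k).
Proof. by move=> x /=; rewrite (rpredDr x (dvdzz k%:Z)) addrAC. Qed.

Lemma eval_iter_left (v : nat -> FZ) m t :
  evalZ v (iter m.*2 Left t) = conjugate m%:Z (evalZ v t).
Proof. by rewrite -iter_left2; elim: (m.*2) => //= j ->. Qed.

(** A join of gaps is the identity as soon as one of the gaps is, and is at most
    the translation by -1 if none is.  The gap of [x] and [1] serves as the join over the
    empty set.  In [F_k] the witness is [step k], which is moved by conjugation by
    any [m] that is not a multiple of [k]. *)
Lemma separating_equation (T : seq nat) n k : (0 < n)%N -> (k %| n)%N ->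
  (forall m, m \in T -> (m %| n)%N) -> (forall m, m \in T -> ~~ (k %| m)%N) ->
  exists e, (forall m, m \in T -> F_satisfies m e) /\ ~ F_satisfies k e.
Proof.
move=> n0 kn Tn Tk.
pose x := Var 0 : term_algebra.
pose tm (s : seq nat) : term := foldr (fun m t =>
  Join (gap n (iter m.*2 Left x : term_algebra) x) t)
  (gap n x (One : term_algebra)) s.
have pconj f m : periodic n f -> periodic n (conjugate m f).
  by move=> pf; apply: (@sub_conjugate (periodic n)) pf; apply: periodic_subuniverse.
have p1 : periodic n FZ_one := sub_one (periodic_subuniverse n).
have gap_le0 f g : periodic n f -> periodic n g ->
    exists c : int, [/\ gap n (f : F_Z) g = translation (- c), 0 <= c,
      f = g -> c = 0 & (exists y, f y <> g y) -> 1 <= c].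
  move=> pf pg; have [c [cE cle [y hy]]] := gapP n0 pf pg.
  exists c; split=> //; first by rewrite -hy.
    by move=> fg; rewrite -hy fg subrr normr0.
  by move=> [z hz]; have := cle z; lia.
exists (tm T, One); split.
  move=> m mT v hvm; have hv i := periodic_dvd (Tn m mT) (hvm i).
  have tm_le s y : evalZ v (tm s) y <= y.
    elim: s => [|j s IH] /=; rewrite eval_gap.
      by have [c [-> c0 _ _]] := gap_le0 _ _ (hv 0%N) p1; rewrite /=; lia.
    have := gap_le0 _ _ (pconj _ j (hv 0%N)) (hv 0%N).
    rewrite eval_iter_left => -[c [-> c0 _ _]] /=.
    by rewrite ge_max IH andbT; lia.
  have tm_ge s y : m \in s -> y <= evalZ v (tm s) y.
    elim: s => //= j s IH; rewrite inE le_max => /orP[/eqP <-|/IH ->]; last first.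
      by rewrite orbT.
    rewrite eval_gap eval_iter_left.
    have [c [-> _ c0 _]] := gap_le0 _ _ (pconj _ m (hv 0%N)) (hv 0%N).
    rewrite c0 /= ?oppr0 ?addr0 ?lexx //.
    by apply: FZ_eq => z /=; rewrite -(hvm 0%N) subrK.
  by apply: FZ_eq => y; apply/eqP; rewrite eq_le tm_le tm_ge.
move=> /(_ (fun=> step k) (fun=> step_periodic k)) /(congr1 (fun f : FZ => f 0)).
set v := fun=> step k => /= eq0.
have pk : periodic n (step k) by apply: periodic_dvd (step_periodic k).
suff : evalZ v (tm T) 0 <= -1 by rewrite eq0.
have : forall m, m \in T -> m \in T by [].
elim: {-2}T => [|m s IH] sT /=; rewrite eval_gap.
  have [c [-> _ _ c1]] := gap_le0 _ _ pk p1.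
  have {}c1 : 1 <= c by apply: c1; exists 0; rewrite /= dvdz0.
  by rewrite /=; lia.
rewrite eval_iter_left ge_max IH ?andbT; last first.
  by move=> j js; apply: sT; rewrite inE js orbT.
have [c [-> _ _ c1]] := gap_le0 _ _ (pconj _ m pk) pk.
have {}c1 : 1 <= c.
  apply: c1; exists 0; rewrite /= dvdz0 add0r dvdzE abszN /=.
  by rewrite (negbTE (Tk m _)) ?addr0 ?addNr // sT ?mem_head.
by rewrite /=; lia.
Qed.

(** * The ideal of subvarieties *)

Lemma F_image_generated (T : set nat) A :
  generated_variety (F_n @` T) A <->
  forall e, (forall k, T k -> F_satisfies k e) -> satisfies A e.
Proof.
rewrite generated_varietyE /=; split=> h e he; apply: h.
  by move=> _ [k Tk <-]; apply/satisfies_F_n; apply: he.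
by move=> k Tk; apply/satisfies_F_n; apply: he; exists k.
Qed.

Lemma subvariety_mem (V : subvariety) (A B : algebra) :
  (V : set algebra) A -> (forall e, satisfies A e -> satisfies B e) ->
  (V : set algebra) B.
Proof.
have [E VE] := subvariety_variety V; rewrite VE /= => VA AB e Ee.
by apply: AB; apply: VA.
Qed.

(** An equation that holds in all [F_k] in [V] with [k] dividing [n], but fails in some
    member of [V], would contradict [failure_at_divisor]. *)
Lemma subvariety_of_F_n (V : subvariety) n : (0 < n)%N ->
  (V : set algebra) `<=` generated_variety (F_n @` [set n]) ->
  exists T : fin_downset, V = downset_subvariety T.
Proof.
move=> n0 VF.
pose T := [set k : nat |
  [/\ (0 < k)%N, (k %| n)%N & (V : set algebra) (F_n k)]].
have Tfin : finite_set T.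
  apply: (@sub_finite_set _ _ [set` iota 0 n.+1]); last exact: finite_seq.
  move=> k [_ kn _]; change (k \in iota 0 n.+1).
  by rewrite mem_iota add0n ltnS /=; apply: dvdn_leq.
have Tgt0 k : T k -> (0 < k)%N by case.
have Tdvd k d : T k -> (d %| k)%N -> T d.
  move=> [k0 kn Vk] dk; split; [exact: dvdn_gt0 dk|exact: dvdn_trans kn|].
  apply: (subvariety_mem Vk) => e /satisfies_F_n Fk; apply/satisfies_F_n.
  exact: F_satisfies_dvd Fk.
exists (FinDownset Tfin Tgt0 Tdvd); apply: subvariety_eq; apply/seteqP; split=> A /=.
  move=> VA; apply/F_image_generated => e Te; apply: contrapT => nA.
  have dlpA := subvariety_DLP VA.
  have hA e' : F_satisfies n e' -> satisfies A e'.
    have /F_image_generated h := VF _ VA => hn; apply: h => _ ->.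
    exact: hn.
  have [k [k0 kn Ak]] := failure_at_divisor n0 dlpA hA nA.
  apply; apply: Te; split=> //.
  by apply: (subvariety_mem VA) => e' /Ak/satisfies_F_n.
apply: generated_variety_sub; first exact: subvariety_variety.
by move=> _ [k [_ _ Vk] <-].
Qed.

(** A common multiple of the indices serves as [n]. *)
Lemma finitely_F_generated_sub_F_n V : finitely_F_generated V ->
  exists2 n : nat, (0 < n)%N &
    (V : set algebra) `<=` generated_variety (F_n @` [set n]).
Proof.
move=> [K [Kfin KF ->]].
have idx (B : algebra) : exists m : nat, K B -> (0 < m)%N /\ F_n m = B.
  have [/KF[m m0 mB]|nK] := pselect (K B); first by exists m.
  by exists 0%N.
have [ix hix] := boolp.choice idx.
have /finite_seqP[s sE] : finite_set (ix @` K) by apply: finite_image.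
exists (\prod_(m <- s | (0 < m)%N) m); first by rewrite prodn_cond_gt0.
apply: generated_variety_sub; first exact: generated_variety_variety.
move=> B KB; apply/F_image_generated => e /(_ _ erefl) he.
have [m0 <-] := hix B KB; apply/satisfies_F_n; apply: F_satisfies_dvd he.
have ms : ix B \in s by have : (ix @` K) (ix B) by [exists B]; rewrite sE.
by rewrite (big_rem (ix B)) //= m0 dvdn_mulr.
Qed.

Lemma downset_subvariety_finitely T : finitely_F_generated (downset_subvariety T).
Proof.
exists (F_n @` T); split=> //; first exact: finite_image (downset_finite T).
by move=> _ [k Tk <-]; exists k => //; apply: downset_gt0 Tk.
Qed.

Lemma downset_subvariety_mono (S T : fin_downset) :
  (S <= T)%O -> (downset_subvariety S <= downset_subvariety T)%O.
Proof.
move=> /asboolP ST; apply/asboolP => /=.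
apply: generated_variety_sub; first exact: generated_variety_variety.
by move=> _ [k /ST Tk <-]; apply: sub_generated_variety; exists k.
Qed.

Lemma downset_subvariety_reflect (S T : fin_downset) :
  (downset_subvariety S <= downset_subvariety T)%O -> (S <= T)%O.
Proof.
move=> /asboolP ST; apply/asboolP => k Sk; apply: contrapT => nTk.
have k0 := downset_gt0 Sk.
have /finite_seqP[s sE] := downset_finite T.
have Ts m : m \in s <-> (T : set nat) m by rewrite sE.
have [||||e [he]] := @separating_equation s (k * \prod_(m <- s) m)%N k.
- rewrite muln_gt0 k0 big_seq_cond prodn_cond_gt0 // => m /andP[/Ts/downset_gt0 //].
- exact: dvdn_mulr.
- by move=> m ms; apply: dvdn_mull; rewrite (big_rem m) //= dvdn_mulr.
- move=> m /Ts Tm; apply/negP => km; apply: nTk; exact: downset_dvd km.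
apply; apply/satisfies_F_n.
have /F_image_generated : generated_variety (F_n @` T) (F_n k).
  by apply: ST; apply: sub_generated_variety; exists k.
by apply=> m Tm; apply: he; apply/Ts.
Qed.

Lemma downset_subvarietyU (S T : fin_downset) :
  downset_subvariety (S `|` T)%O =
  (downset_subvariety S `|` downset_subvariety T)%O.
Proof.
apply/eqP; rewrite eq_le leUx !downset_subvariety_mono ?leUl ?leUr // !andbT.
apply/asboolP.
apply: (generated_variety_sub (generated_variety_variety _)).
move=> _ [k [Sk|Tk] <-]; apply: sub_generated_variety; [left|right];
  by apply: sub_generated_variety; exists k.
Qed.

Theorem theorem6p17 :
  lattice_ideal finitely_F_generated /\
  lattice_iso_onto downset_subvariety finitely_F_generated.
Proof.
have below V W : finitely_F_generated W -> (V <= W)%O ->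
    exists T, V = downset_subvariety T.
  move=> /finitely_F_generated_sub_F_n[n n0 Wn] /asboolP VW.
  apply: (subvariety_of_F_n n0); exact: subset_trans VW Wn.
have onto V : finitely_F_generated V -> exists T, V = downset_subvariety T.
  by move=> /below; apply; apply: lexx.
have le_iff S T : (downset_subvariety S <= downset_subvariety T)%O = (S <= T)%O.
  by apply/idP/idP; [exact: downset_subvariety_reflect|exact: downset_subvariety_mono].
split; split.
- pose S0 := @FinDownset set0 (finite_set0 _) (fun _ => @False_ind _)
    (fun _ _ => @False_ind _).
  by exists (downset_subvariety S0); apply: downset_subvariety_finitely.
- move=> V W FW /(below _ _ FW)[T ->]; exact: downset_subvariety_finitely.
- move=> V W /onto[S ->] /onto[T ->]; rewrite -downset_subvarietyU.
  exact: downset_subvariety_finitely.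
- split.
  + by move=> T _; apply: downset_subvariety_finitely.
  + by move=> S T _ _ eq; apply/eqP; rewrite eq_le -!le_iff eq lexx.
  + by move=> V /onto[T ->]; exists T.
(* Since the range is an ideal, the meet of two members comes from a downset, and
   reflection of the order puts it below both. *)
- move=> S T; apply/eqP; rewrite eq_le lexI !le_iff leIl leIr /=.
  have [|U UE] := below (downset_subvariety S `&` downset_subvariety T)%O _
    (downset_subvariety_finitely S); first exact: leIl.
  by rewrite UE le_iff lexI -!le_iff -UE leIl leIr.
- exact: downset_subvarietyU.
Qed.
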